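(* Let $\mathfrak a$ be one of $\mathfrak{o}_{2n+1}$, $\mathfrak{sp}_{2n}$, $\mathfrak{o}_{2n}$. Consider the set of elements of the extended Yangian $X(\mathfrak a)$ consisting of all $t_{ij}^{(r)}$ and all $z_r$ with $$i+j>0,\quad r\ge1,\qquad\text{in the orthogonal case},$$ and $$i+j\ge0,\quad r\ge1,\qquad\text{in the symplectic case}.$$ Then, for any total ordering on this set, the ordered monomials in these elements form a basis of $X(\mathfrak a)$.
   Context: Ground field $\mathbb C$. $\mathfrak a=\mathfrak{o}_{2n+1}$ ($N=2n+1$, $n\ge1$), $\mathfrak{sp}_{2n}$ ($N=2n$, $n\ge1$) or $\mathfrak{o}_{2n}$ ($N=2n$, $n\ge2$). All matrix indices run over $\{-n,\dots,-1,1,\dots,n\}$ if $N=2n$ and over $\{-n,\dots,n\}$ if $N=2n+1$ (index $0$ is skipped in sums when $N=2n$). Put $\theta_{ij}=1$ in the orthogonal case and $\theta_{ij}=\operatorname{sgn}i\cdot\operatorname{sgn}j$ in the symplectic case; $\kappa=N/2-1$ in the orthogonal case and $\kappa=N/2+1$ in the symplectic case. The extended Yangian $X(\mathfrak a)$ is the unital associative algebra with generators $t_{ij}^{(r)}$ ($r\ge1$) and, with $t_{ij}(u)=\delta_{ij}+\sum_{r\ge1}t_{ij}^{(r)}u^{-r}$, defining relations (understood after multiplying by $(u-v)(u-v-\kappa)$) $$[t_{ij}(u),t_{kl}(v)]=\frac{1}{u-v}\big(t_{kj}(u)t_{il}(v)-t_{kj}(v)t_{il}(u)\big)-\frac{1}{u-v-\kappa}\Big(\delta_{k,-i}\sum_{p}\theta_{ip}t_{pj}(u)t_{-p,l}(v)-\delta_{l,-j}\sum_{p}\theta_{jp}t_{k,-p}(v)t_{ip}(u)\Big).$$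 The elements $z_r$ are the coefficients of the series $z(u)=1+z_1u^{-1}+z_2u^{-2}+\cdots$ determined by $\sum_i\theta_{ki}\,t_{-i,-k}(u+\kappa)\,t_{il}(u)=\delta_{kl}z(u)$ (for all $k,l$). *)

(* Defs.v *)
From HB Require Import structures.
From mathcomp Require Import all_boot all_order all_algebra.
From mathcomp Require Import boolp reals.
From mathcomp Require Export complex.
From mathcomp Require Import finmap monalg.
From mathcomp Require Import zify ring.

Set Implicit Arguments.
Unset Strict Implicit.
Unset Printing Implicit Defensive.

Import Order.TTheory GRing.Theory Num.Theory.
Local Open Scope ring_scope.

Lemma mulr_subE (A : pzRingType) (x x' y y' : A) :
  x' * y' - x * y = (x' - x) * y' + x * (y' - y).
Proof. by rewrite mulrBl mulrBr addrA subrK. Qed.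

Variant lie_type := OddOrthogonal | Symplectic | EvenOrthogonal.

Definition admissible_rank (a : lie_type) (n : nat) : bool :=
  if a is EvenOrthogonal then (2 <= n)%N else (1 <= n)%N.

Definition dimN (a : lie_type) (n : nat) : nat :=
  if a is OddOrthogonal then (2 * n).+1 else (2 * n)%N.

Definition has_index0 (a : lie_type) : bool :=
  if a is OddOrthogonal then true else false.

Definition indices (a : lie_type) (n : nat) : seq int :=
  [seq i <- [seq k%:Z - n%:Z | k <- iota 0 (2 * n).+1]
     | has_index0 a || (i != 0)].

Definition idx (a : lie_type) (n : nat) := seq_sub (indices a n).

Lemma mem_indices a n (i : int) :
  (i \in indices a n) = (`|i| <= n%:Z) && (has_index0 a || (i != 0)).
Proof.
rewrite mem_filter andbC; congr (_ && _); apply/mapP/idP.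
  by move=> [k]; rewrite mem_iota => /andP[_ hk] ->; lia.
by move=> hi; exists (absz (i + n%:Z)); rewrite ?mem_iota; lia.
Qed.

Lemma opp_indices a n (i : idx a n) : - val i \in indices a n.
Proof. by have := valP i; rewrite !mem_indices normrN oppr_eq0. Qed.

Definition opp_idx a n (i : idx a n) : idx a n := SeqSub (opp_indices i).

Definition theta (a : lie_type) (i j : int) : int :=
  if a is Symplectic then sgz i * sgz j else 1.

Lemma thetaC a i j : theta a i j = theta a j i.
Proof. by case: a => //=; rewrite mulrC. Qed.

Definition kappa (K : fieldType) (a : lie_type) (n : nat) : K :=
  if a is Symplectic then (dimN a n)%:R / 2 + 1 else (dimN a n)%:R / 2 - 1.

(* A sequence [f : nat -> A] stands for the power series
   \sum_(r >= 0) f r u^-r, and a function [F : int -> int -> A] for the family of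
   coefficients of u^-r v^-s, where r and s may be negative. *)
Section Series.
Context (K : fieldType) (A : lalgType K).
Implicit Types (f g : nat -> A) (F : int -> int -> A).

(* The series extended by zero to negative exponents. *)
Definition coefz f (r : int) : A := if r is Posz m then f m else 0.

(* The coefficients of (u - v - c) F(u, v). *)
Definition mul_uvB (c : K) F : int -> int -> A :=
  fun r s => F (r + 1) s - F r (s + 1) - c *: F r s.

Definition smul f g : nat -> A := fun m => \sum_(r < m.+1) f r * g (m - r)%N.

(* The series f(u + c): for r > 0 the coefficient of u^-m in (u + c)^-r is
   binom(- r, m - r) c^(m - r) = (- c)^(m - r) binom(m - 1, m - r), and for
   r = 0 the binomial coefficient below is 1 if m = 0 and 0 otherwise. *)
Definition sshift (c : K) f : nat -> A :=
  fun m => \sum_(r < m.+1) ((- c) ^+ (m - r) *+ 'C(m.-1, m - r)) *: f r.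

End Series.

Section Relations.
Context (K : fieldType) (a : lie_type) (n : nat) (A : lalgType K).
Variable t : idx a n -> idx a n -> nat -> A.

Definition th (i j : idx a n) : K := (theta a (val i) (val j))%:~R.

Definition rtt_commutator (i j k l : idx a n) : int -> int -> A := fun r s =>
  coefz (t i j) r * coefz (t k l) s - coefz (t k l) s * coefz (t i j) r.

Definition rtt_P (i j k l : idx a n) : int -> int -> A := fun r s =>
  coefz (t k j) r * coefz (t i l) s - coefz (t k j) s * coefz (t i l) r.

Definition rtt_Q (i j k l : idx a n) : int -> int -> A := fun r s =>
  (k == opp_idx i)%:R *:
    (\sum_p th i p *: (coefz (t p j) r * coefz (t (opp_idx p) l) s))
  - (l == opp_idx j)%:R *:
    (\sum_p th j p *: (coefz (t k (opp_idx p)) s * coefz (t i p) r)).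

(* The defining relation multiplied by (u - v) (u - v - kappa) reads
   (u - v) (u - v - kappa) [t_ij(u), t_kl(v)] = (u - v - kappa) P - (u - v) Q,
   where P and Q are the expressions multiplied by 1 / (u - v) and
   - 1 / (u - v - kappa) in the original relation. *)
Definition rtt_lhs (i j k l : idx a n) : int -> int -> A :=
  mul_uvB 0 (mul_uvB (kappa K a n) (rtt_commutator i j k l)).

Definition rtt_rhs (i j k l : idx a n) : int -> int -> A := fun r s =>
  mul_uvB (kappa K a n) (rtt_P i j k l) r s - mul_uvB 0 (rtt_Q i j k l) r s.

Definition z_summand (k l i : idx a n) : nat -> A := fun m =>
  th k i *: smul (sshift (kappa K a n) (t (opp_idx i) (opp_idx k))) (t i l) m.

(* \sum_i theta_ki t_-i,-k(u + kappa) t_il(u) = delta_kl z(u). *)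
Definition is_zseries (z : nat -> A) : Prop :=
  forall (k l : idx a n) (m : nat),
    \sum_i z_summand k l i m = (k == l)%:R *: z m.

End Relations.

Section Augmentation.
Context (K : fieldType) (a : lie_type) (n : nat) (A : lalgType K).
Variables (t : idx a n -> idx a n -> nat -> A) (e : {rmorphism A -> K}).
Hypothesis eZ : forall c x, e (c *: x) = c * e x.
Hypothesis et : forall i j r, e (t i j r) = ((i == j) && (r == 0)%N)%:R.

Lemma augmentation_coefz i j (r : int) :
  e (coefz (t i j) r) = (i == j)%:R * (r == 0)%:R.
Proof.
case: r => r /=; last by rewrite rmorph0 mulr0.
by rewrite et -natrM mulnb.
Qed.

Lemma augmentation_mul_uvB c (F : int -> int -> A) r s :
  e (mul_uvB c F r s) = e (F (r + 1) s) - e (F r (s + 1)) - c * e (F r s).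
Proof. by rewrite /mul_uvB !rmorphB eZ. Qed.

Lemma thC (i j : idx a n) : th K i j = th K j i.
Proof. by rewrite /th thetaC. Qed.

Lemma augmentation_relator i j k l r s :
  e (rtt_lhs t i j k l r s - rtt_rhs t i j k l r s) = 0.
Proof.
have hC r' s' : e (rtt_commutator t i j k l r' s') = 0.
  by rewrite /rtt_commutator rmorphB !rmorphM mulrC subrr.
have hP r' s' : e (rtt_P t i j k l r' s') = 0.
  by rewrite /rtt_P rmorphB !rmorphM /= !augmentation_coefz; ring.
have hQ r' s' : e (rtt_Q t i j k l r' s') = 0.
  rewrite /rtt_Q rmorphB !eZ !rmorph_sum (bigD1 j) //=.
  rewrite [X in _ - _ * X](bigD1 i) //=.
  rewrite [\sum_(p | p != j) _]big1; last first.
  - move=> p hp; rewrite eZ rmorphM /= !augmentation_coefz.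
    by rewrite (negbTE hp) !mul0r !mulr0.
  rewrite [\sum_(p | p != i) _]big1; last first.
  - move=> p hp; rewrite eZ rmorphM /= !augmentation_coefz.
    by rewrite [i == p]eq_sym (negbTE hp) mul0r !mulr0.
  rewrite !addr0 !eZ !rmorphM /= !augmentation_coefz.
  by rewrite !eqxx (thC j i) [opp_idx j == l]eq_sym; ring.

have el : e (rtt_lhs t i j k l r s) = 0.
  by rewrite /rtt_lhs !augmentation_mul_uvB !hC; ring.
have er : e (rtt_rhs t i j k l r s) = 0.
  rewrite [LHS](rmorphB e (mul_uvB _ _ r s) (mul_uvB _ _ r s)).
  by rewrite !augmentation_mul_uvB !hP !hQ; ring.
by rewrite rmorphB el er subrr.
Qed.

End Augmentation.

Section RelationMorphism.
Context (K : fieldType) (a : lie_type) (n : nat) (A B : lalgType K).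
Variables (t : idx a n -> idx a n -> nat -> A) (f : {rmorphism A -> B}).
Hypothesis fZ : forall c x, f (c *: x) = c *: f x.

Let ft (i j : idx a n) (r : nat) : B := f (t i j r).

Lemma coefz_morph i j r : coefz (ft i j) r = f (coefz (t i j) r).
Proof. by case: r => r //=; rewrite rmorph0. Qed.

Lemma mul_uvB_morph c (F : int -> int -> A) (G : int -> int -> B) :
  (forall r s, G r s = f (F r s)) ->
  forall r s, mul_uvB c G r s = f (mul_uvB c F r s).
Proof. by move=> e r s; rewrite /mul_uvB !e !rmorphB fZ. Qed.

Lemma rtt_morph i j k l r s :
  f (rtt_lhs t i j k l r s - rtt_rhs t i j k l r s) =
  rtt_lhs ft i j k l r s - rtt_rhs ft i j k l r s.
Proof.
rewrite rmorphB; congr (_ - _); apply/esym.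
  do 2 apply: mul_uvB_morph => ? ?.
  by rewrite /rtt_commutator !coefz_morph rmorphB !rmorphM.
rewrite [RHS](rmorphB f (mul_uvB _ _ r s) (mul_uvB _ _ r s)).
congr (_ - _); apply: mul_uvB_morph => {}r {}s.
  by rewrite /rtt_P !coefz_morph rmorphB !rmorphM.
rewrite /rtt_Q rmorphB !fZ !rmorph_sum; congr (_ *: _ - _ *: _).
  by apply: eq_bigr => p _; rewrite !coefz_morph fZ rmorphM.
by apply: eq_bigr => p _; rewrite !coefz_morph fZ rmorphM.
Qed.

End RelationMorphism.

Lemma malg_scaleAr (M : monomType) (R : comNzRingType) c (x y : {malg R[M]}) :
  c *: (x * y) = x * (c *: y).
Proof.
apply/malgP => k; rewrite mcoeffZ.
rewrite (mcoeffMlw k (fsubset_refl _) (msuppZ_le c y)) mcoeffMl mulr_sumr.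
apply: eq_bigr => k1 _; rewrite mulr_sumr; apply: eq_bigr => k2 _.
by rewrite mcoeffZ mulrnAr mulrCA.
Qed.

(* The free algebra on the symbols t_ij^(r), r >= 1; the generator (i, j, r)
   stands for t_ij^(r + 1). *)
Section FreeAlgebra.
Context (K : fieldType) (a : lie_type) (n : nat).

Definition gen : choiceType := (idx a n * idx a n * nat)%type.

Definition free_alg := {malg K[{fmonom gen}]}.

Definition free_t (i j : idx a n) (r : nat) : free_alg :=
  if r is r'.+1 then << fmu (i, j, r') >> else (i == j)%:R.

Definition is_relator (x : free_alg) : Prop :=
  exists (i j k l : idx a n) (r s : int),
    x = rtt_lhs free_t i j k l r s - rtt_rhs free_t i j k l r s.

Inductive rel_ideal : free_alg -> Prop :=
| rel_ideal0 : rel_ideal 0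
| rel_idealD x y : rel_ideal x -> rel_ideal y -> rel_ideal (x + y)
| rel_idealM b x c : is_relator x -> rel_ideal (b * x * c).


Lemma rel_idealN x : rel_ideal x -> rel_ideal (- x).
Proof.
elim=> [|u v _ hu _ hv|b u c hu]; first by rewrite oppr0; exact: rel_ideal0.
  by rewrite opprD; exact: rel_idealD.
by rewrite -!mulNr; exact: rel_idealM.
Qed.

Lemma rel_idealMl b x : rel_ideal x -> rel_ideal (b * x).
Proof.
elim=> [|u v _ hu _ hv|d u c hu]; first by rewrite mulr0; exact: rel_ideal0.
  by rewrite mulrDr; exact: rel_idealD.
by rewrite !mulrA; exact: rel_idealM.
Qed.

Lemma rel_idealMr b x : rel_ideal x -> rel_ideal (x * b).
Proof.
elim=> [|u v _ hu _ hv|d u c hu]; first by rewrite mul0r; exact: rel_ideal0.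
  by rewrite mulrDl; exact: rel_idealD.
by rewrite -!mulrA mulrA; exact: rel_idealM.
Qed.

(* [Quotient.quot] takes a boolean predicate. *)
Definition rel_ideal_pred : {pred free_alg} := fun x => `[< rel_ideal x >].

Lemma rel_ideal_zmod_closed : zmod_closed rel_ideal_pred.
Proof.
split=> [|x y]; first exact/asboolP/rel_ideal0.
move=> /asboolP hx /asboolP hy; apply/asboolP/rel_idealD => //.
exact: rel_idealN.
Qed.

HB.instance Definition _ :=
  GRing.isZmodClosed.Build free_alg rel_ideal_pred rel_ideal_zmod_closed.

(* The constant term, i.e. the algebra morphism sending every t_ij^(r) to 0,
   kills the ideal, so the quotient below is nonzero. *)
Definition counit (x : free_alg) : K := mcoeff (mone : {fmonom gen}) x.

Lemma counitM x y : counit (x * y) = counit x * counit y.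
Proof. exact: rmorphM. Qed.

Lemma counit_t i j r : counit (free_t i j r) = ((i == j) && (r == 0))%:R.
Proof.
case: r => [|r] /=; rewrite /counit.
  by rewrite andbT rmorph_nat.
rewrite andbF mcoeffU1; case: eqP => // /(congr1 (@fmonom_val _)).
by rewrite fm1 /fmu !fmE.
Qed.

Lemma counit_relator x : is_relator x -> counit x = 0.
Proof.
move=> [i [j [k [l [r [s ->]]]]]].
apply: (@augmentation_relator K a n _ free_t (mcoeff mone)).
  by move=> c y; exact: mcoeffZ.
exact: counit_t.
Qed.

Lemma counit_rel_ideal x : rel_ideal x -> counit x = 0.
Proof.
elim=> [|u v _ hu _ hv|b u c /counit_relator hu]; first exact: raddf0.
  by rewrite /counit mcoeffD; apply: etrans (addr0 0); congr (_ + _).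
by rewrite !counitM hu mulr0 mul0r.
Qed.

Definition ext_yangian := Quotient.quot rel_ideal_pred.

HB.instance Definition _ := GRing.Zmodule.on ext_yangian.

Definition ey_pi (x : free_alg) : ext_yangian := \pi_(ext_yangian)%qT x.

Lemma ey_piP (x y : free_alg) : ey_pi x = ey_pi y <-> rel_ideal (x - y).
Proof.
rewrite -(asboolE (rel_ideal _)) -[asbool _]/(x - y \in rel_ideal_pred).
by rewrite Quotient.idealrBE; split=> /eqP.
Qed.

Lemma ey_pi_surj (x : ext_yangian) : ey_pi (repr x) = x.
Proof. exact: reprK. Qed.

Lemma ey_piD x y : ey_pi (x + y) = ey_pi x + ey_pi y.
Proof. exact: (@Quotient.pi_add free_alg rel_ideal_pred). Qed.

Lemma ey_piN x : ey_pi (- x) = - ey_pi x.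
Proof. exact: (@Quotient.pi_opp free_alg rel_ideal_pred). Qed.

Definition ey_one : ext_yangian := ey_pi 1.
Definition ey_mul (x y : ext_yangian) : ext_yangian :=
  ey_pi (repr x * repr y).
Definition ey_scale (c : K) (x : ext_yangian) : ext_yangian :=
  ey_pi (c *: repr x).

Lemma ey_repr_pi x : rel_ideal (repr (ey_pi x) - x).
Proof. by apply/ey_piP; rewrite ey_pi_surj. Qed.

Lemma ey_piM x y : ey_pi (x * y) = ey_mul (ey_pi x) (ey_pi y).
Proof.
apply/esym/ey_piP.
rewrite mulr_subE.
by apply: rel_idealD; [apply: rel_idealMr|apply: rel_idealMl];
  exact: ey_repr_pi.
Qed.

Lemma ey_piZ c x : ey_pi (c *: x) = ey_scale c (ey_pi x).
Proof.
apply/esym/ey_piP; rewrite -scalerBr -mul_malgC.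
by apply: rel_idealMl; exact: ey_repr_pi.
Qed.

Lemma ey_mulA : associative ey_mul.
Proof.
move=> x y z; rewrite -[x]ey_pi_surj -[y]ey_pi_surj -[z]ey_pi_surj.
by rewrite -!ey_piM mulrA.
Qed.

Lemma ey_mul1x : left_id ey_one ey_mul.
Proof. by move=> x; rewrite -[x]ey_pi_surj -ey_piM mul1r. Qed.

Lemma ey_mulx1 : right_id ey_one ey_mul.
Proof. by move=> x; rewrite -[x]ey_pi_surj -ey_piM mulr1. Qed.

Lemma ey_mulDl : left_distributive ey_mul +%R.
Proof.
move=> x y z; rewrite -[x]ey_pi_surj -[y]ey_pi_surj -[z]ey_pi_surj.
by rewrite -ey_piD -!ey_piM -ey_piD mulrDl.
Qed.

Lemma ey_mulDr : right_distributive ey_mul +%R.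
Proof.
move=> x y z; rewrite -[x]ey_pi_surj -[y]ey_pi_surj -[z]ey_pi_surj.
by rewrite -ey_piD -!ey_piM -ey_piD mulrDr.
Qed.

Lemma ey_one_neq0 : ey_one != 0.
Proof.
apply/eqP => h; have : ey_pi 1 = ey_pi (1 - 1).
  by rewrite ey_piD ey_piN subrr; exact: h.
move=> /ey_piP /counit_rel_ideal; rewrite subrr subr0.
rewrite [counit 1](rmorph1 (mcoeff mone)) => /eqP.
by rewrite oner_eq0.
Qed.

HB.instance Definition _ := GRing.Zmodule_isNzRing.Build ext_yangian
  ey_mulA ey_mul1x ey_mulx1 ey_mulDl ey_mulDr ey_one_neq0.

Lemma ey_scaleA b c x : ey_scale b (ey_scale c x) = ey_scale (b * c) x.
Proof. by rewrite -[x]ey_pi_surj -!ey_piZ scalerA. Qed.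

Lemma ey_scale1 : left_id 1 ey_scale.
Proof. by move=> x; rewrite -[x]ey_pi_surj -ey_piZ scale1r. Qed.

Lemma ey_scaleDr : right_distributive ey_scale +%R.
Proof.
move=> c x y; rewrite -[x]ey_pi_surj -[y]ey_pi_surj.
by rewrite -ey_piD -!ey_piZ -ey_piD scalerDr.
Qed.

Lemma ey_scaleDl x : {morph ey_scale^~ x : b c / b + c}.
Proof.
move=> b c; rewrite -[x]ey_pi_surj /=.
by rewrite -!ey_piZ -ey_piD scalerDl.
Qed.

HB.instance Definition _ := GRing.Zmodule_isLmodule.Build K ext_yangian
  ey_scaleA ey_scale1 ey_scaleDr ey_scaleDl.

Lemma ey_mulE x y : ey_pi x * ey_pi y = ey_pi (x * y).
Proof. exact/esym/ey_piM. Qed.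

Lemma ey_scaleE c x : c *: ey_pi x = ey_pi (c *: x).
Proof. exact/esym/ey_piZ. Qed.

Lemma ey_scaleAl c (x y : ext_yangian) : c *: (x * y) = (c *: x) * y.
Proof.
rewrite -[x]ey_pi_surj -[y]ey_pi_surj.
by rewrite ey_scaleE !ey_mulE ey_scaleE scalerAl.
Qed.

HB.instance Definition _ :=
  GRing.Lmodule_isLalgebra.Build K ext_yangian ey_scaleAl.

Lemma ey_scaleAr c (x y : ext_yangian) : c *: (x * y) = x * (c *: y).
Proof.
rewrite -[x]ey_pi_surj -[y]ey_pi_surj.
by rewrite ey_scaleE !ey_mulE ey_scaleE malg_scaleAr.
Qed.

HB.instance Definition _ :=
  GRing.Lalgebra_isAlgebra.Build K ext_yangian ey_scaleAr.

Lemma ey_pi_is_zmod_morphism : zmod_morphism ey_pi.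
Proof. by move=> x y; rewrite ey_piD ey_piN. Qed.

Lemma ey_pi_is_monoid_morphism : monoid_morphism ey_pi.
Proof. by split; [exact: erefl|exact: ey_piM]. Qed.

HB.instance Definition _ :=
  GRing.isZmodMorphism.Build free_alg ext_yangian ey_pi ey_pi_is_zmod_morphism.
HB.instance Definition _ :=
  GRing.isMonoidMorphism.Build free_alg ext_yangian ey_pi
    ey_pi_is_monoid_morphism.

(* The coefficient of u^-r in t_ij(u). *)
Definition ey_t (i j : idx a n) (r : nat) : ext_yangian := ey_pi (free_t i j r).

Lemma ey_t0 i j : ey_t i j 0 = (i == j)%:R.
Proof. by rewrite /ey_t /= rmorph_nat. Qed.

Lemma ey_rtt i j k l r s : rtt_lhs ey_t i j k l r s = rtt_rhs ey_t i j k l r s.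
Proof.
apply/eqP; rewrite -subr_eq0; apply/eqP.
have hZ c x : ey_pi (c *: x) = c *: ey_pi x by exact/esym/ey_scaleE.
rewrite -(@rtt_morph K a n _ _ free_t ey_pi hZ).
rewrite -[RHS](rmorph0 ey_pi); apply/ey_piP.
rewrite subr0 -[X in rel_ideal X]mulr1 -[X in rel_ideal (X * _)]mul1r.
by apply: rel_idealM; exists i, j, k, l, r, s.
Qed.

End FreeAlgebra.

(* Existence of z(u): multiply the defining relation by u - v - kappa, then
   substitute u = v + kappa. *)
Section Substitution.
Context (K : fieldType) (A : algType K) (c : K).

Fixpoint subst_step (f : nat -> K) (m : nat) : K :=
  if m is m'.+1 then f m - c * subst_step f m' else f 0%N.

(* [subst_coef p m] is the coefficient of v^(2 - p - m) in (v + c)^(2 - p). *)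
Definition subst_coef (p : nat) : nat -> K :=
  iter p subst_step (fun m => c ^+ m *+ 'C(2, m)).

Lemma subst_step_ext f g : f =1 g -> subst_step f =1 subst_step g.
Proof. by move=> fg; elim=> [|m IH] /=; rewrite ?fg ?IH. Qed.

Lemma subst_stepP f m : subst_step f m.+1 + c * subst_step f m = f m.+1.
Proof. by rewrite /= subrK. Qed.

Lemma subst_coef1 m : subst_coef 1 m = c ^+ m *+ 'C(1, m).
Proof.
rewrite /subst_coef /=; case: m => [|[|[|m]]] /=.
- by [].
- by rewrite !bin1 bin0; ring.
- by rewrite bin1 bin0 binn bin_small //; ring.
elim: m => [|m IH]; last by move: IH; rewrite /= => ->; rewrite !bin_small //; ring.
by rewrite /= bin1 bin0 binn !bin_small //; ring.
Qed.

Lemma subst_coefE r m : subst_coef r.+2 m = (- c) ^+ m *+ 'C((r + m).-1, m).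
Proof.
elim: r m => [|r IHr] m.
  rewrite /subst_coef iterS (subst_step_ext subst_coef1).
  case: m => [|m] //; rewrite add0n bin_small //= mulr0n.
  elim: m => [|m IH]; first by rewrite /= bin1 bin0; ring.
  by rewrite /= [X in c * X]IH bin_small // mulr0n mulr0 subr0.
rewrite /subst_coef iterS (subst_step_ext IHr).
elim: m => [|m IH]; first by rewrite /= !bin0.
rewrite [LHS]/= IH addSn /= !addnS /= binS mulrnDr exprS; ring.
Qed.

Definition subst_weight (d p q : nat) : K :=
  if (p + q <= d)%N then subst_coef p (d - p - q) else 0.

Lemma subst_weight_rec d p q :
  subst_weight d p q.+1 = subst_weight d p.+1 q + c * subst_weight d p.+1 q.+1.
Proof.
rewrite /subst_weight !addnS !addSn; case: ltnP => h; last first.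
  by rewrite ltnNge (leq_trans h) // mulr0 addr0.
case: ltnP => h'.
  have -> : (d - p.+1 - q = (d - p.+1 - q.+1).+1)%N by lia.
  have -> : (d - p - q.+1 = (d - p.+1 - q.+1).+1)%N by lia.
  by rewrite /subst_coef iterS subst_stepP.
have -> : (d - p.+1 - q = 0)%N by lia.
have -> : (d - p - q.+1 = 0)%N by lia.
by rewrite mulr0 addr0.
Qed.

Implicit Types F G : int -> int -> A.

(* The coefficient of v^-m in F(v + c, v). *)
Definition subst (m : nat) F : A :=
  \sum_(p < m.+4.+1) \sum_(q < m.+4.+1)
    subst_weight m.+4 p q *: F (p%:Z - 2) (q%:Z - 2).

Lemma eq_subst m F G : (forall r s, F r s = G r s) -> subst m F = subst m G.
Proof.
by move=> e; apply: eq_bigr => p _; apply: eq_bigr => q _; rewrite e.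
Qed.

Lemma substD m F G : subst m (fun r s => F r s + G r s) = subst m F + subst m G.
Proof.
rewrite -big_split; apply: eq_bigr => p _; rewrite -big_split.
by apply: eq_bigr => q _; rewrite scalerDr.
Qed.

Lemma substZ m b F : subst m (fun r s => b *: F r s) = b *: subst m F.
Proof.
rewrite scaler_sumr; apply: eq_bigr => p _; rewrite scaler_sumr.
by apply: eq_bigr => q _; rewrite !scalerA mulrC.
Qed.

Lemma subst_sum m (I : finType) (F : I -> int -> int -> A) :
  subst m (fun r s => \sum_i F i r s) = \sum_i subst m (F i).
Proof.
rewrite exchange_big; apply: eq_bigr => p _; rewrite exchange_big.
by apply: eq_bigr => q _; rewrite scaler_sumr.
Qed.

Lemma substB m F G : subst m (fun r s => F r s - G r s) = subst m F - subst m G.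
Proof.
rewrite -[- subst m G]scaleN1r -substZ -substD.
by apply: eq_subst => r s; rewrite scaleN1r.
Qed.

Definition low_support F :=
  forall r s : int, (r < -1) || (s < -1) -> F r s = 0.

Lemma subst_mul0 m F : low_support F -> subst m (mul_uvB c F) = 0.
Proof.
move=> lF; rewrite /subst /mul_uvB; set d := m.+4.
pose y (p q : nat) : A := F (p%:Z - 1) (q%:Z - 1).
pose w := subst_weight d.
have e1 : \sum_(p < d.+1) \sum_(q < d.+1)
    w p q *: F (p%:Z - 2 + 1) (q%:Z - 2) = \sum_(p < d) \sum_(q < d) w p q.+1 *: y p q.
  rewrite big_ord_recr /= [X in _ + X]big1 ?addr0; last first.
    move=> [[|q] hq] _ /=; first by rewrite lF ?scaler0 //; lia.
    by rewrite /w /subst_weight ifF ?scale0r //; lia.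
  apply: eq_bigr => p _; rewrite big_ord_recl /= lF ?scaler0 ?add0r; last by lia.
  apply: eq_bigr => q _; rewrite /bump /y /=; congr (_ *: F _ _); lia.
have e2 : \sum_(p < d.+1) \sum_(q < d.+1)
    w p q *: F (p%:Z - 2) (q%:Z - 2 + 1) = \sum_(p < d) \sum_(q < d) w p.+1 q *: y p q.
  rewrite big_ord_recl [X in X + _]big1 ?add0r /=; last first.
    by move=> q _; rewrite lF ?scaler0 ?orbT //; lia.
  apply: eq_bigr => p _; rewrite big_ord_recr /=.
  rewrite [X in _ + X](_ : _ = 0) ?addr0; last first.
    by rewrite /w /bump /subst_weight ifF ?scale0r //; lia.
  apply: eq_bigr => q _; rewrite /y /=; congr (_ *: F _ _); lia.
have e3 : \sum_(p < d.+1) \sum_(q < d.+1)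
    w p q *: F (p%:Z - 2) (q%:Z - 2) = \sum_(p < d) \sum_(q < d) w p.+1 q.+1 *: y p q.
  rewrite big_ord_recl [X in X + _]big1 ?add0r /=; last first.
    by move=> q _; rewrite lF ?scaler0 ?orbT //; lia.
  apply: eq_bigr => p _; rewrite big_ord_recl /= lF ?scaler0 ?add0r ?orbT //. 
transitivity (\sum_(p < d) \sum_(q < d)
  (w p q.+1 - w p.+1 q - c * w p.+1 q.+1) *: y p q); last first.
  rewrite big1 // => p _; rewrite big1 // => q _.
  rewrite /w subst_weight_rec; rewrite [X in X *: _](_ : _ = 0) ?scale0r //; ring.
have -> : \sum_(p < d) \sum_(q < d)
  (w p q.+1 - w p.+1 q - c * w p.+1 q.+1) *: y p q =
  \sum_(p < d) \sum_(q < d) w p q.+1 *: y p q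
  - \sum_(p < d) \sum_(q < d) w p.+1 q *: y p q
  - c *: \sum_(p < d) \sum_(q < d) w p.+1 q.+1 *: y p q.
  rewrite scaler_sumr -!sumrB; apply: eq_bigr => p _.
  rewrite scaler_sumr -!sumrB; apply: eq_bigr => q _.
  by rewrite !scalerBl scalerA.
rewrite -e1 -e2 -e3 scaler_sumr -!sumrB; apply: eq_bigr => p _.
rewrite scaler_sumr -!sumrB; apply: eq_bigr => q _.
by rewrite !scalerBr !scalerA [c * _]mulrC.
Qed.

Lemma big_ord_trim (N N' : nat) (F : nat -> A) : (N <= N')%N ->
  (forall i, (N <= i)%N -> F i = 0) -> \sum_(i < N') F i = \sum_(i < N) F i.
Proof.
move=> le F0; rewrite (big_ord_widen N' F le) [RHS]big_mkcond /=.
by apply: eq_bigr => i _; case: ltnP => // /F0.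
Qed.

Lemma subst_prod m (f g : nat -> A) :
  subst m (fun r s => coefz f r * coefz g s) = smul (sshift c f) g m.
Proof.
pose H (r s : nat) : A :=
  if (r + s <= m)%N then subst_coef r.+2 (m - r - s) *: (f r * g s) else 0.
transitivity (\sum_(r < m.+3) \sum_(s < m.+3) H r s).
  have drop (N : nat) (F : nat -> A) : F 0%N = 0 -> F 1%N = 0 ->
      \sum_(p < N.+2) F p = \sum_(p < N) F p.+2.
    by move=> F0 F1; rewrite 2!big_ord_recl /= F0 F1 !add0r.
  rewrite /subst (drop _ (fun p => \sum_(q < m.+4.+1)
    subst_weight m.+4 p q *: (coefz f (p%:Z - 2) * coefz g (q%:Z - 2)))).
  - apply: eq_bigr => r _.
    rewrite (drop _ (fun q => subst_weight m.+4 r.+2 q *: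
      (coefz f (r.+2%:Z - 2) * coefz g (q%:Z - 2)))) ?mulr0 ?scaler0 //.
    apply: eq_bigr => s _.
    have -> : r.+2%:Z - 2 = r%:Z by lia.
    have -> : s.+2%:Z - 2 = s%:Z by lia.
    rewrite /H /subst_weight !addSn !addnS !ltnS /=.
    by case: ifP => h; rewrite ?scale0r // !subSS -!subnDA !addnS !subSS.
  - by rewrite big1 // => q _; rewrite /= mul0r scaler0.
  - by rewrite big1 // => q _; rewrite /= mul0r scaler0.
rewrite exchange_big /= (@big_ord_trim m.+1 m.+3 (fun s => \sum_(r < m.+3) H r s)) //.
  rewrite (reindex_inj rev_ord_inj); apply: eq_bigr => k _ /=; rewrite subSS.
  have hk := ltn_ord k.
  rewrite (@big_ord_trim k.+1 m.+3 (fun r => H r (m - k)%N)); last 2 first.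
  - lia.
  - by move=> r hr; rewrite /H ifF //; lia.
  rewrite /sshift mulr_suml; apply: eq_bigr => r _; have hr := ltn_ord r.
  rewrite /H ifT; last by lia.
  rewrite subst_coefE -scalerAl (_ : (m - r - (m - k) = k - r)%N); last by lia.
  by rewrite subnKC.
  lia.
by move=> s hs; rewrite big1 // => r _; rewrite /H ifF //; lia.
Qed.

End Substitution.

Section ZSeries.
Context (K : fieldType) (a : lie_type) (n : nat) (A : algType K).
Variable t : idx a n -> idx a n -> nat -> A.
Hypothesis rtt : forall i j k l r s, rtt_lhs t i j k l r s = rtt_rhs t i j k l r s.
Hypothesis kappa_neq0 : kappa K a n != 0.

Lemma opp_idxK : involutive (@opp_idx a n).
Proof. by move=> i; apply: val_inj; rewrite /= opprK. Qed.

Lemma th_mul (i j l : idx a n) : th K i j * th K i l = th K j l.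
Proof.
rewrite /th -intrM; congr _%:~R; rewrite /theta.
have := valP i; rewrite mem_indices => /andP[_].
move: (val i) (val j) (val l) => i' j' l'.
by case: (a) => //= hi; rewrite mulrACA mulz_sg hi mul1r.
Qed.

Lemma th_oppr (i j : idx a n) : th K i (opp_idx j) = th K (opp_idx i) j.
Proof.
rewrite /th /theta /=; congr _%:~R.
move: (val i) (val j) => i' j'.
by case: (a) => //; rewrite !sgzN mulrN mulNr.
Qed.

Local Notation ku := (kappa K a n).

Lemma mul_uvB_sub (c : K) (F G : int -> int -> A) r s :
  mul_uvB c (fun r s => F r s - G r s) r s = mul_uvB c F r s - mul_uvB c G r s.
Proof.
have sub4 (x y z w : A) : (x - y) - (z - w) = (x - z) - (y - w).
  by rewrite !opprD !opprK addrACA.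
by rewrite /mul_uvB scalerBr [X in X - _]sub4 [LHS]sub4.
Qed.

Lemma mul_uvB_comm (c : K) (F : int -> int -> A) r s :
  mul_uvB 0 (mul_uvB c F) r s = mul_uvB c (mul_uvB 0 F) r s.
Proof.
have e (G : int -> int -> A) r' s' :
    mul_uvB c G r' s' = mul_uvB 0 G r' s' - c *: G r' s'.
  by rewrite /mul_uvB scale0r subr0.
rewrite [RHS]e -[LHS](_ : mul_uvB 0 (fun r s => mul_uvB 0 F r s - c *: F r s) r s = _); last first.
  by rewrite /mul_uvB !scale0r !subr0.
rewrite mul_uvB_sub; congr (_ - _).
by rewrite /mul_uvB !scale0r !subr0 scalerBr.
Qed.

Lemma low_support_coefz (f g : nat -> A) r s :
  (r < 0) || (s < 0) -> coefz f r * coefz g s = 0.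
Proof. by case: r s => r [] s //= _; rewrite ?mul0r ?mulr0. Qed.

Lemma rtt_Q_support i j k l r s :
  (r < 0) || (s < 0) -> rtt_Q t i j k l r s = 0.
Proof.
move=> h; rewrite /rtt_Q !big1 ?scaler0 ?subr0 // => p _.
  by rewrite low_support_coefz 1?orbC ?scaler0.
by rewrite low_support_coefz ?scaler0.
Qed.

Lemma subst_rtt_Q m i j k l : subst ku m (rtt_Q t i j k l) = 0.
Proof.
pose X := rtt_commutator t i j k l; pose P := rtt_P t i j k l.
pose Q := rtt_Q t i j k l.
pose Y r s := P r s - mul_uvB 0 X r s.
have X0 r s : (r < 0) || (s < 0) -> X r s = 0.
  by move=> h; rewrite /X /rtt_commutator !low_support_coefz ?subrr // orbC.
have P0 r s : (r < 0) || (s < 0) -> P r s = 0.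
  by move=> h; rewrite /P /rtt_P !low_support_coefz ?subrr // orbC.
have lY : low_support Y.
  move=> r s h; rewrite /Y /mul_uvB P0 ?X0; try lia.
  by rewrite scaler0 !subr0.
have lQ : low_support Q by move=> r s h; rewrite /Q rtt_Q_support //; lia.
have e r s : ku *: Q r s = mul_uvB ku Y r s - mul_uvB ku Q r s.
  have := rtt i j k l r s; rewrite /rtt_lhs /rtt_rhs -/X -/P -/Q => h.
  have {h} h : mul_uvB 0 Q r s = mul_uvB ku P r s - mul_uvB 0 (mul_uvB ku X) r s.
    by rewrite h opprB addrC subrK.
  have -> : mul_uvB ku Y r s = mul_uvB 0 Q r s.
    by rewrite h mul_uvB_comm -mul_uvB_sub.
  by rewrite /mul_uvB scale0r subr0 subKr.
have : subst ku m (fun r s => ku *: Q r s) = 0.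
  rewrite (eq_subst _ _ e) substB !subst_mul0 ?subrr //.
by rewrite substZ => /eqP; rewrite scaler_eq0 (negbTE kappa_neq0) => /eqP.
Qed.

Definition z_witness (i0 : idx a n) (m : nat) : A :=
  \sum_p th K i0 p *: subst ku m
    (fun r s => coefz (t (opp_idx i0) (opp_idx p)) s * coefz (t i0 p) r).

Lemma subst_rtt_QE m i j k l : subst ku m (rtt_Q t i j k l) =
  (k == opp_idx i)%:R *:
    (\sum_p th K i p *: smul (sshift ku (t p j)) (t (opp_idx p) l) m)
  - (l == opp_idx j)%:R *:
    (\sum_p th K j p *: subst ku m
       (fun r s => coefz (t k (opp_idx p)) s * coefz (t i p) r)).
Proof.
rewrite /rtt_Q substB !substZ !subst_sum; congr (_ *: _ - _ *: _).
  by apply: eq_bigr => p _; rewrite substZ subst_prod.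
by apply: eq_bigr => p _; rewrite substZ.
Qed.

Lemma z_witnessP (i0 : idx a n) : is_zseries t (z_witness i0).
Proof.
move=> k l m; rewrite /z_summand (reindex_inj (inv_inj opp_idxK)) /=.
have := subst_rtt_QE m i0 (opp_idx k) (opp_idx i0) l.
rewrite subst_rtt_Q eqxx scale1r opp_idxK => /esym/eqP.
rewrite subr_eq0 => /eqP e.
transitivity (th K i0 (opp_idx k) *: ((l == k)%:R *:
   \sum_p th K (opp_idx k) p *: subst ku m
   (fun r s => coefz (t (opp_idx i0) (opp_idx p)) s * coefz (t i0 p) r))).
  rewrite -e scaler_sumr; apply: eq_bigr => p _.
  by rewrite scalerA opp_idxK th_oppr th_mul.
rewrite scalerA mulrC -scalerA eq_sym; congr (_ *: _).
rewrite scaler_sumr; apply: eq_bigr => p _.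
by rewrite scalerA (thC K i0) th_mul.
Qed.

Lemma zseries_exists_unique (i0 : idx a n) :
  exists! z : nat -> A, is_zseries t z.
Proof.
exists (z_witness i0); split; first exact: z_witnessP.
move=> z hz; apply/funext => m.
have := z_witnessP i0 i0 i0 m; rewrite hz eqxx !scale1r => /esym; exact.
Qed.

End ZSeries.

Lemma kappa_neq0 (K : numFieldType) a n :
  admissible_rank a n -> kappa K a n != 0.
Proof.
have h (N : nat) : (2 < N)%N -> N%:R / 2 - 1 != 0 :> K.
  move=> N2; have -> : N%:R / 2 - 1 = (N - 2)%N%:R / 2 :> K.
    by rewrite natrB ?(ltnW N2) //; field.
  by rewrite mulf_neq0 ?invr_neq0 ?pnatr_eq0 //; lia.
case: a => /= hn; rewrite /kappa /dimN; try by apply: h; lia.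
have -> : (2 * n)%N%:R / 2 + 1 = (n + 1)%N%:R :> K.
  by rewrite natrM natrD; field.
by rewrite pnatr_eq0; lia.
Qed.

(* The condition [is_zseries] determines z(u), and it can be satisfied. *)
Lemma ext_yangian_zseries (K : numFieldType) a n : admissible_rank a n ->
  exists! z : nat -> ext_yangian K a n, is_zseries (@ey_t K a n) z.
Proof.
move=> hn.
have i0 : idx a n.
  by exists n%:Z; rewrite mem_indices; case: a hn => /= hn; lia.
exact: zseries_exists_unique (@ey_rtt K a n) (kappa_neq0 K hn) i0.
Qed.

Definition is_basis (K : fieldType) (V : lmodType K) (I : choiceType)
    (b : I -> V) : Prop :=
  (forall (s : seq I) (c : I -> K), uniq s ->
     \sum_(i <- s) c i *: b i = 0 -> forall i, i \in s -> c i = 0) /\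
  (forall x : V, exists (s : seq I) (c : I -> K), x = \sum_(i <- s) c i *: b i).

Definition total_order (T : eqType) (le : rel T) : Prop :=
  [/\ reflexive le, antisymmetric le, transitive le & total le].

Definition pbw_cond (a : lie_type) (n : nat) (p : idx a n * idx a n) : bool :=
  if a is Symplectic then 0 <= val p.1 + val p.2 else 0 < val p.1 + val p.2.

(* [inl ((i, j), r)] stands for t_ij^(r + 1) and [inr r] for z_(r + 1). *)
Definition pbw_index (a : lie_type) (n : nat) : choiceType :=
  ({p : idx a n * idx a n | pbw_cond p} * nat + nat)%type.

Definition pbw_elt (K : fieldType) (a : lie_type) (n : nat)
    (z : nat -> ext_yangian K a n) (g : pbw_index a n) : ext_yangian K a n :=
  match g with
  | inl (p, r) => ey_t K (val p).1 (val p).2 r.+1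
  | inr r => z r.+1
  end.

(* Main.v *)
(* Filter X(a) by the degree r - 1 of t_ij^(r). Modulo lower terms the generators
   commute, and t_ij^(r) + theta_ij t_-j,-i^(r) = delta_ij z_r, so ordered monomials
   span. For independence, comultiply with the vector representation
   t_ij(u) |-> delta_ij - E_ji / (u - x) + theta_ij E_-i,-j / (u - x - kappa), x a
   variable, and extract the coefficient of a matrix unit times x^(r-1): this gives
   an operator on X(a) which, modulo lower terms, is a derivation of degree 1 - r
   that picks out t_ij^(r) among the generators. The automorphism
   t(u) |-> (1 + x u^-r) t(u) does the same for z_r. Applying these operators
   successively to a linear relation isolates each leading coefficient. *)

From HB Require Import structures.
Require Import Defs.
From mathcomp Require Import all_boot all_order all_algebra.
From mathcomp Require Import boolp reals.
From mathcomp Require Import finmap monalg.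
From mathcomp Require Import zify ring.

Set Implicit Arguments.
Unset Strict Implicit.
Unset Printing Implicit Defensive.

Import Order.TTheory GRing.Theory Num.Theory.
Local Open Scope ring_scope.

(** * The filtration by degree and length *)

(** Nothing is known beforehand about the associated graded algebra. What stands in for such
    knowledge is that the filtration is spanned by words, so that its part of negative degree, or of
    degree 0 and negative length, is zero. An operator that lowers degree and length far enough
    therefore kills exactly, and not only up to lower terms. The operators are the matrix
    coefficients of Delta - id, for homomorphisms Delta from X(a) to matrices over X(a)[x]. A
    difference of two homomorphisms obeys the Leibniz rule up to the product of the two differences,
    which is shorter by two; the exponent of x records by how much the degree drops. The scalar
    twist does not see z_r alone: it takes the value 1 on every diagonal t_ii^(r) and 2 on z_r. The
    vector operators of the diagonal generators are therefore subtracted from it, and the result is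
    halved. Repeated letters in a monomial turn the extracted coefficient into a positive integer
    multiple, which is harmless in characteristic 0. *)

Section Filtration.
Context (K : fieldType) (a : lie_type) (n : nat) (X : algType K).
Variable t : idx a n -> idx a n -> nat -> X.
Local Notation gen := (gen a n).
Implicit Types (x y : X) (w : seq gen).

Definition tword w : X := \prod_(g <- w) t g.1.1 g.1.2 g.2.+1.

Definition wdeg w : nat := \sum_(g <- w) g.2.

(* The associated graded algebra of the degree filtration is commutative only
   up to words of the same degree and smaller length, so words are compared
   lexicographically by degree and length. *)
Definition below (d l d' l' : int) : bool := (d < d') || (d <= d') && (l <= l').

Lemma belowD d1 l1 d2 l2 d1' l1' d2' l2' :
  below d1 l1 d1' l1' -> below d2 l2 d2' l2' ->
  below (d1 + d2) (l1 + l2) (d1' + d2') (l1' + l2').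
Proof. by rewrite /below /=; lia. Qed.

Lemma below_trans d1 l1 d2 l2 d3 l3 :
  below d1 l1 d2 l2 -> below d2 l2 d3 l3 -> below d1 l1 d3 l3.
Proof. by rewrite /below /=; lia. Qed.

Lemma below_refl d l : below d l d l.
Proof. by rewrite /below /=; lia. Qed.

(** The bounds are integers because the operators used for independence lower them below zero. For d
    > 0 a negative l still admits all words of degree less than d, whatever their length. *)
Inductive filt (d l : int) : X -> Prop :=
| filt0 : filt d l 0
| filtD x y : filt d l x -> filt d l y -> filt d l (x + y)
| filtW c w : below (wdeg w)%:Z (size w)%:Z d l -> filt d l (c *: tword w).

Lemma tword_cat w v : tword (w ++ v) = tword w * tword v.
Proof. by rewrite /tword big_cat. Qed.

Lemma wdeg_cat w v : wdeg (w ++ v) = (wdeg w + wdeg v)%N.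
Proof. by rewrite /wdeg big_cat. Qed.

Lemma filtZ d l c x : filt d l x -> filt d l (c *: x).
Proof.
elim=> [|u v _ hu _ hv|b w h]; first by rewrite scaler0; exact: filt0.
  by rewrite scalerDr; exact: filtD.
by rewrite scalerA; exact: filtW.
Qed.

Lemma filtN d l x : filt d l x -> filt d l (- x).
Proof. by rewrite -scaleN1r; exact: filtZ. Qed.

Lemma filtB d l x y : filt d l x -> filt d l y -> filt d l (x - y).
Proof. by move=> hx /filtN; exact: filtD. Qed.

Lemma filt_sum d l (I : Type) (r : seq I) (P : pred I) (F : I -> X) :
  (forall i, P i -> filt d l (F i)) -> filt d l (\sum_(i <- r | P i) F i).
Proof. by move=> h; apply: big_ind => //; [exact: filt0|exact: filtD]. Qed.

Lemma filt_le d l d' l' x : below d l d' l' -> filt d l x -> filt d' l' x.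
Proof.
move=> h; elim=> [|u v _ hu _ hv|b w hw]; first exact: filt0.
  exact: filtD.
by apply: filtW; exact: below_trans hw h.
Qed.

Lemma filtM d l d' l' x y :
  filt d l x -> filt d' l' y -> filt (d + d') (l + l') (x * y).
Proof.
elim=> [|u v _ hu _ hv|b w hw] h; first by rewrite mul0r; exact: filt0.
  by rewrite mulrDl; apply: filtD; auto.
elim: h => [|u v _ hu _ hv|c v hv]; first by rewrite mulr0; exact: filt0.
  by rewrite mulrDr; exact: filtD.
rewrite -scalerAl -scalerAr scalerA -tword_cat; apply: filtW.
by rewrite wdeg_cat size_cat !PoszD; exact: belowD.
Qed.

Lemma filtMZ d l d' l' d2 l2 x y : below (d + d') (l + l') d2 l2 ->
  filt d l x -> filt d' l' y -> filt d2 l2 (x * y).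
Proof. by move=> h hx hy; exact: filt_le h (filtM hx hy). Qed.

Lemma filt1 d l : 0 <= d -> 0 <= l -> filt d l 1.
Proof.
move=> d0 l0; rewrite -[1]scale1r -[X in _ *: X](_ : tword [::] = 1).
  by apply: filtW; rewrite /wdeg big_nil /below /=; lia.
by rewrite /tword big_nil.
Qed.

Lemma filt_nat d l (m : nat) : 0 <= d -> 0 <= l -> filt d l m%:R.
Proof. by move=> d0 l0; rewrite -scaler_nat; exact/filtZ/filt1. Qed.

Lemma filt_t i j r : filt r%:Z 1 (t i j r.+1).
Proof.
rewrite -[t _ _ _]scale1r -[X in _ *: X](_ : tword [:: (i, j, r)] = _).
  by apply: filtW; rewrite /wdeg big_seq1; exact: below_refl.
by rewrite /tword big_seq1.
Qed.

Hypothesis t0 : forall i j, t i j 0 = (i == j)%:R.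
Hypothesis rtt : forall i j k l r s, rtt_lhs t i j k l r s = rtt_rhs t i j k l r s.

(** With both exponents positive the product has degree r + s - 2 and length 2, lexicographically
    below (r + s - 1, 1). If one exponent is 0, that factor is a scalar and one generator of degree
    r + s - 1 is left. At (0, 0) the bound would be -1, so the constant term must be treated
    separately: in P and Q below it cancels. *)
Lemma filt_tt i j k l (r s : int) : (r, s) != (0, 0) ->
  filt (r + s - 1) 1 (coefz (t i j) r * coefz (t k l) s).
Proof.
case: r s => [[|r]|r] [[|s]|s] //= _; rewrite ?mul0r ?mulr0; try exact: filt0.
- rewrite t0 mulr_natl -scaler_nat; apply/filtZ.
  by apply: filt_le (filt_t k l s); rewrite /below /=; lia.
- rewrite t0 mulr_natr -scaler_nat; apply/filtZ.
  by apply: filt_le (filt_t i j r); rewrite /below /=; lia.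
- by apply: filtMZ (filt_t i j r) (filt_t k l s); rewrite /below /=; lia.
Qed.

Lemma filt_rtt_P i j k l r s : filt (r + s - 1) 1 (rtt_P t i j k l r s).
Proof.
rewrite /rtt_P; case: (eqVneq (r, s) (0, 0)) => [[-> ->]|h].
  by rewrite /= !t0 [X in filt _ _ X]subrr; exact: filt0.
apply: filtB; first exact: filt_tt.
rewrite [r + s]addrC; apply: filt_tt; apply: contra h => /eqP[-> ->].
by rewrite eqxx.
Qed.

Lemma filt_rtt_Q i j k l r s : filt (r + s - 1) 1 (rtt_Q t i j k l r s).
Proof.
rewrite /rtt_Q; case: (eqVneq (r, s) (0, 0)) => [[-> ->]|h].
  rewrite /= (bigD1 j) //= [X in _ - _ *: X](bigD1 i) //= !t0 !eqxx.
  rewrite [\sum_(p | p != j) _]big1 ?addr0; last first.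
    by move=> p hp; rewrite !t0 (negbTE hp) mul0r scaler0.
  rewrite [\sum_(p | p != i) _]big1 ?addr0; last first.
    by move=> p hp; rewrite !t0 [i == p]eq_sym (negbTE hp) mulr0 scaler0.
  rewrite mul1r mulr1 (thC K j i) [opp_idx j == l]eq_sym.
  case: (k == _); case: (l == _);
    by rewrite ?scale0r ?scaler0 ?[X in filt _ _ X]subrr; exact: filt0.
apply: filtB; apply/filtZ/filt_sum => p _; apply/filtZ; first exact: filt_tt.
rewrite [r + s]addrC; apply: filt_tt; apply: contra h => /eqP[-> ->].
by rewrite eqxx.
Qed.

(** The relation multiplied by (u - v) (u - v - kappa) is read as a recursion that expresses the
    coefficient with the largest power of u^-1 through coefficients with a smaller one. It starts at
    exponents r <= 0, where t_ij(u) has scalar coefficients and the commutator vanishes. *)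
Lemma filt_rtt_commutator i j k l (r s : int) :
  filt (r + s - 2) 1 (rtt_commutator t i j k l r s).
Proof.
have : forall s' r' : int, r' <= 0 -> rtt_commutator t i j k l r' s' = 0.
  move=> s' r'; rewrite /rtt_commutator; case: r' => [[|r']|r'] //= _.
    by rewrite t0 mulr_natl mulr_natr subrr.
  by rewrite mul0r mulr0 subrr.
have := rtt i j k l; rewrite /rtt_lhs.
move: (rtt_commutator t i j k l) => C hC C0.
case: (lerP r 0) => [h|]; first by rewrite C0 //; exact: filt0.
case: r => // r _; have [m] := ubnP r; elim: m => // m IH in r s *.
rewrite ltnS => hr.
have {}IH r' s' : r' < r%:Z -> filt (r' + s' - 2) 1 (C r' s').
  case: r' => [[|r']|r'] hr'; try by rewrite C0 //; exact: filt0.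
  by apply: IH; lia.
case: r hr IH => [|r] hr IH; first by rewrite C0 //; exact: filt0.
(* The coefficient of the relation at (q, s) has leading term [C (q + 2) s], since each of the two
   linear factors raises an exponent by at most one; [q] may be -1. *)
pose q := r%:Z - 1; have er : r.+1%:Z = q + 1 + 1 by rewrite /q; lia.
have := hC q s; rewrite /mul_uvB !scale0r !subr0 -er.
have lift d' e x : filt d' 1 x -> d' <= e -> filt e 1 x.
  by move=> hx he; apply: filt_le hx; rewrite /below /=; lia.
have {}IH r' s' : r' < r.+1%:Z -> r' + s' - 2 <= q + s -> filt (q + s) 1 (C r' s').
  by move=> h1 h2; apply: lift (IH _ _ h1) h2.
have {hC} hR : filt (q + s) 1 (rtt_rhs t i j k l q s).
  have hP := filt_rtt_P i j k l; have hQ := filt_rtt_Q i j k l.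
  rewrite /rtt_rhs /mul_uvB scale0r subr0.
  have hP' r' s' : r' + s' <= q + s + 1 -> filt (q + s) 1 (rtt_P t i j k l r' s').
    by move=> h; apply: lift (hP _ _) _; lia.
  have hQ' r' s' : r' + s' <= q + s + 1 -> filt (q + s) 1 (rtt_Q t i j k l r' s').
    by move=> h; apply: lift (hQ _ _) _; lia.
  by do ?[by apply: hP'; lia | by apply: hQ'; lia | apply: filtB | apply: filtZ].
have -> : r.+1%:Z + s - 2 = q + s by rewrite er; lia.
move=> e; have -> : C r.+1%:Z s = rtt_rhs t i j k l q s +
    (C (q + 1) (s + 1) - C q (s + 1 + 1) - kappa K a n *: C q (s + 1)) +
    kappa K a n *: C (q + 1) s + C (q + 1) (s + 1).
  by rewrite -e !subrK.
by do ?[exact: hR | apply: IH; rewrite /q; lia | apply: filtB | apply: filtD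
  | apply: filtZ].
Qed.

Lemma filt_tC i j k l r s :
  filt (r%:Z + s%:Z) 1 (t i j r.+1 * t k l s.+1 - t k l s.+1 * t i j r.+1).
Proof.
by apply: filt_le (filt_rtt_commutator i j k l r.+1 s.+1); rewrite /below /=; lia.
Qed.

(** The Leibniz rule in both arguments reduces to two generators. The degree need not drop, but each
    commutator is shorter by one. *)
Lemma filt_comm d l d' l' x y : filt d l x -> filt d' l' y ->
  filt (d + d') (l + l' - 1) (x * y - y * x).
Proof.
have comW w v : filt ((wdeg w)%:Z + (wdeg v)%:Z) ((size w)%:Z + (size v)%:Z - 1)
    (tword w * tword v - tword v * tword w).
  elim: w => [|g w IHw].
    by rewrite /tword big_nil mul1r mulr1 subrr; exact: filt0.
  rewrite -cat1s tword_cat wdeg_cat size_cat.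
  set x1 := tword [:: g]; set z := tword v; set y1 := tword w in IHw *.
  have -> : x1 * y1 * z - z * (x1 * y1) = x1 * (y1 * z - z * y1) +
      (x1 * z - z * x1) * y1 by rewrite mulrBr mulrBl !mulrA addrA subrK.
  have hg : filt (wdeg [:: g])%:Z 1 x1.
    by rewrite -[x1]scale1r; apply: filtW; exact: below_refl.
  have hw : filt (wdeg w)%:Z (size w)%:Z y1.
    by rewrite -[y1]scale1r; apply: filtW; exact: below_refl.
  apply: filtD; first by apply: filtMZ hg IHw; rewrite /below /=; lia.
  have: filt ((wdeg [:: g])%:Z + (wdeg v)%:Z) (size v)%:Z (x1 * z - z * x1).
    rewrite {}/z; elim: v {IHw} => [|h v IHv].
      by rewrite /tword big_nil mul1r mulr1 subrr; exact: filt0.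
    rewrite -(cat1s h v) tword_cat wdeg_cat size_cat.
    set y2 := tword [:: h]; set z2 := tword v in IHv *.
    have -> : x1 * (y2 * z2) - y2 * z2 * x1 = (x1 * y2 - y2 * x1) * z2 +
        y2 * (x1 * z2 - z2 * x1) by rewrite mulrBr mulrBl !mulrA addrA subrK.
    have hh : filt (wdeg [:: h])%:Z 1 y2.
      by rewrite -[y2]scale1r; apply: filtW; exact: below_refl.
    have hv : filt (wdeg v)%:Z (size v)%:Z z2.
      by rewrite -[z2]scale1r; apply: filtW; exact: below_refl.
    apply: filtD; last by apply: filtMZ hh IHv; rewrite /below /=; lia.
    have hc : filt ((wdeg [:: g])%:Z + (wdeg [:: h])%:Z) 1 (x1 * y2 - y2 * x1).
      by rewrite /x1 /y2 /tword /wdeg !big_seq1; exact: filt_tC.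
    by apply: filtMZ hc hv; rewrite /below /=; lia.
  by move=> hc; apply: filtMZ hc hw; rewrite /below /=; lia.
elim=> [|u v _ hu _ hv|b w hw] h.
- by rewrite mul0r mulr0 subrr; exact: filt0.
- rewrite mulrDl mulrDr opprD addrACA.
  by apply: filtD; [exact: hu|exact: hv].
elim: h => [|u v _ hu _ hv|c v hv].
- by rewrite mul0r mulr0 subrr; exact: filt0.
- by rewrite mulrDl mulrDr opprD addrACA; exact: filtD.
rewrite -!scalerAl -!scalerAr !scalerA [c * b]mulrC -scalerBr.
apply/filtZ; apply: filt_le (comW w v).
by move: hw hv; rewrite /below /=; lia.
Qed.

End Filtration.

(** * Ordered monomials span *)

Section Spanning.
Context (K : fieldType) (a : lie_type) (n : nat) (X : algType K).
Variable t : idx a n -> idx a n -> nat -> X.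
Hypothesis t0 : forall i j, t i j 0 = (i == j)%:R.
Hypothesis rtt : forall i j k l r s, rtt_lhs t i j k l r s = rtt_rhs t i j k l r s.
Variable z : nat -> X.
Hypothesis zP : is_zseries t z.
Local Notation filt := (filt t).
Local Notation tword := (tword t).
Local Notation gen := (gen a n).
Local Notation pbw := (pbw_index a n).

Lemma sshift0 c (f : nat -> X) : sshift c f 0 = f 0%N.
Proof. by rewrite /sshift big_ord1 /= scale1r. Qed.

Lemma filt_sshift c i j m :
  filt m%:Z 0 (sshift c (t i j) m.+1 - t i j m.+1).
Proof.
rewrite /sshift big_ord_recr /= subnn expr0 bin0 mulr1n scale1r addrK.
apply: filt_sum => -[[|q] /= hq] _; apply: filtZ.
  by rewrite t0; exact: filt_nat.
by apply: filt_le (filt_t t i j q); rewrite /below /=; lia.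
Qed.

Lemma th_diag (i : idx a n) : th K i i = 1.
Proof.
rewrite /th /theta; have := valP i; rewrite mem_indices => /andP[_].
move: (val i) => i'; case: (a) => //= hi.
by rewrite mulz_sg hi.
Qed.

(** In the product of two series only the extreme terms, with one factor a constant term, matter:
    t^(p+1) t^(m-p) has degree p + (m - p - 1) = m - 1. The shift by kappa also changes a
    coefficient only by terms of smaller degree. *)
Lemma filt_z_summand k l i m : filt m%:Z 0 (z_summand t k l i m.+1 -
  ((k == i)%:R *: t i l m.+1 +
   (i == l)%:R *: (th K k i *: t (opp_idx i) (opp_idx k) m.+1))).
Proof.
rewrite /z_summand /smul big_ord_recl big_ord_recr /= subnn subn0 sshift0 !t0.
rewrite (inj_eq (inv_inj (@opp_idxK a n))) [i == k]eq_sym.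
set S := \sum_(_ < _) _.
set y := sshift _ _ _.
have -> : th K k i *: ((k == i)%:R * t i l m.+1 + (S + y * (i == l)%:R)) -
  ((k == i)%:R *: t i l m.+1 +
   (i == l)%:R *: (th K k i *: t (opp_idx i) (opp_idx k) m.+1)) =
  th K k i *: S + (i == l)%:R *: (th K k i *: (y - t (opp_idx i) (opp_idx k) m.+1)).
  rewrite scalerDr.
  have -> : th K k i *: ((k == i)%:R * t i l m.+1) = (k == i)%:R *: t i l m.+1.
    by case: eqP => [->|]; rewrite ?th_diag ?mul1r ?mul0r ?scaler0 ?scale1r
      ?scale0r.
  rewrite scalerDr opprD addrACA subrr add0r -addrA; congr (_ + _).
  by case: (i == l); rewrite ?mulr1 ?mulr0 ?scale1r ?scale0r ?scaler0 ?subr0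
    ?scalerBr.
apply: filtD; apply: filtZ; last by apply/filtZ; exact: filt_sshift.
apply: filt_sum => p _; have hp := ltn_ord p.
have h : filt p%:Z 1 (sshift (kappa K a n) (t (opp_idx i) (opp_idx k)) p.+1).
  rewrite -[sshift _ _ _](subrK (t (opp_idx i) (opp_idx k) p.+1)).
  apply: filtD; last exact: filt_t.
  by apply: filt_le (filt_sshift _ _ _ _); rewrite /below /=; lia.
rewrite /bump /= add1n subSS -(subnSK hp).
by apply: filtMZ h (filt_t t i l _); rewrite /below /=; lia.
Qed.

Lemma filt_z k l m : filt m%:Z 0 ((k == l)%:R *: z m.+1 -
  (t k l m.+1 + th K k l *: t (opp_idx l) (opp_idx k) m.+1)).
Proof.
rewrite -zP.
have -> : t k l m.+1 + th K k l *: t (opp_idx l) (opp_idx k) m.+1 =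
  \sum_i ((k == i)%:R *: t i l m.+1 +
   (i == l)%:R *: (th K k i *: t (opp_idx i) (opp_idx k) m.+1)).
  rewrite big_split /=; congr (_ + _).
    rewrite (bigD1 k) //= eqxx scale1r big1 ?addr0 // => i.
    by rewrite eq_sym => /negbTE ->; rewrite scale0r.
  rewrite (bigD1 l) //= eqxx scale1r big1 ?addr0 // => i.
  by move=> /negbTE ->; rewrite scale0r.
by rewrite -sumrB; apply: filt_sum => i _; exact: filt_z_summand.
Qed.

(** [pbw_elt] over an arbitrary algebra [X] with a solution [t]; the two agree by conversion on the
    extended Yangian. *)
Definition pbw_gen (g : pbw) : X :=
  match g with
  | inl (p, r) => t (val p).1 (val p).2 r.+1
  | inr r => z r.+1
  end.

Definition pbw_deg (g : pbw) : nat :=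
  match g with inl (_, r) => r | inr r => r end.

Definition pword (w : seq pbw) : X := \prod_(g <- w) pbw_gen g.

Definition pdeg (w : seq pbw) : nat := \sum_(g <- w) pbw_deg g.

Lemma pword_cat w v : pword (w ++ v) = pword w * pword v.
Proof. by rewrite /pword big_cat. Qed.

Lemma pdeg_cat w v : pdeg (w ++ v) = (pdeg w + pdeg v)%N.
Proof. by rewrite /pdeg big_cat. Qed.

Variable i0 : idx a n.

Lemma filt_pbw_gen g : filt (pbw_deg g)%:Z 1 (pbw_gen g).
Proof.
case: g => [[p r]|r] /=; first exact: filt_t.
have := filt_z i0 i0 r; rewrite eqxx scale1r => h.
rewrite -[z r.+1](subrK (t i0 i0 r.+1 +
  th K i0 i0 *: t (opp_idx i0) (opp_idx i0) r.+1)).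
apply: filtD; first by apply: filt_le h; rewrite /below /=; lia.
by apply: filtD; last apply: filtZ; exact: filt_t.
Qed.

Lemma filt_pword w : filt (pdeg w)%:Z (size w)%:Z (pword w).
Proof.
elim: w => [|g w IH]; first by rewrite /pword /pdeg !big_nil; exact: filt1.
rewrite /pword /pdeg !big_cons.
by apply: filtMZ (filt_pbw_gen g) IH; rewrite /below /pdeg /=; lia.
Qed.

Lemma filt_perm w v : perm_eq w v ->
  filt (pdeg w)%:Z ((size w)%:Z - 1) (pword w - pword v).
Proof.
elim: w v => [|g w IH] v hv.
  by move: hv; rewrite perm_sym => /perm_nilP ->; rewrite subrr; exact: filt0.
have gv : g \in v by rewrite -(perm_mem hv) mem_head.
case/splitPr: gv hv => v1 v2.
rewrite perm_sym -[g :: v2]cat1s perm_catCA /= perm_cons perm_sym => hv.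
have e : pdeg w = (pdeg v1 + pdeg v2)%N.
  by rewrite -pdeg_cat /pdeg; apply: perm_big.
have es := perm_size hv; rewrite size_cat in es.
rewrite -(cat1s g w) -(cat1s g v2) !pword_cat pdeg_cat e.
set x := pword [:: g]; set y1 := pword v1; set y2 := pword v2.
have -> : x * pword w - y1 * (x * y2) =
    x * (pword w - pword (v1 ++ v2)) + (x * y1 - y1 * x) * y2.
  by rewrite pword_cat mulrBr mulrBl !mulrA addrA subrK.
apply: filtD.
  by apply: filtMZ (filt_pword _) (IH _ hv); rewrite e /below /=; lia.
apply: filtMZ (filt_comm t0 rtt (filt_pword _) (filt_pword _)) (filt_pword v2).
rewrite /below /= es.
by move: (pdeg v1) (pdeg v2) (pdeg [:: g]) (size v1) (size v2) => *; lia.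
Qed.

End Spanning.

(** The involution (i, j) -> (-j, -i) changes the sign of i + j. Both pairs can fail the condition
    only if i + j = 0 in the orthogonal case, and then the pair is fixed. *)
Lemma pbw_cond_anti (a : lie_type) (n : nat) (i j : idx a n) :
  ~~ pbw_cond (i, j) -> ~~ pbw_cond (opp_idx j, opp_idx i) ->
  j = opp_idx i /\ theta a (val i) (val j) = 1.
Proof.
move=> hij hji.
suff [eij ->] : val j = - val i /\ theta a (val i) (val j) = 1.
  by split=> //; apply: val_inj; rewrite eij.
move: hij hji; rewrite /pbw_cond /theta /=.
by move: (val i) (val j) => i' j'; case: (a) => /=; lia.
Qed.

(** * Rewriting words in the chosen generators *)

Section SpanningPBW.
Context (K : numFieldType) (a : lie_type) (n : nat) (X : algType K).
Variable t : idx a n -> idx a n -> nat -> X.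
Hypothesis t0 : forall i j, t i j 0 = (i == j)%:R.
Hypothesis rtt : forall i j k l r s, rtt_lhs t i j k l r s = rtt_rhs t i j k l r s.
Variable z : nat -> X.
Hypothesis zP : is_zseries t z.
Local Notation filt := (filt t).
Local Notation tword := (tword t).
Local Notation pbw := (pbw_index a n).
Local Notation pword := (pword t z).
Implicit Types (Q : seq pbw -> Prop).

Definition pspan Q (x : X) : Prop := exists2 L : seq (K * seq pbw),
  (forall cw, cw \in L -> Q cw.2) & x = \sum_(cw <- L) cw.1 *: pword cw.2.

Lemma pspan0 Q : pspan Q 0.
Proof. by exists [::]; rewrite ?big_nil. Qed.

Lemma pspanD Q x y : pspan Q x -> pspan Q y -> pspan Q (x + y).
Proof.
move=> [L hL ->] [M hM ->]; exists (L ++ M); last by rewrite big_cat.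
by move=> cw; rewrite mem_cat => /orP[]; auto.
Qed.

Lemma pspanZ Q c x : pspan Q x -> pspan Q (c *: x).
Proof.
move=> [L hL ->]; exists [seq (c * cw.1, cw.2) | cw <- L].
  by move=> _ /mapP[cw hcw ->] /=; apply: hL hcw.
by rewrite big_map scaler_sumr; apply: eq_bigr => cw _; rewrite scalerA.
Qed.

Lemma pspan_word Q w : Q w -> pspan Q (pword w).
Proof.
move=> hw; exists [:: (1, w)]; last by rewrite big_seq1 scale1r.
by move=> cw; rewrite inE => /eqP ->.
Qed.

Lemma pspan_ind Q (P : X -> Prop) x : P 0 ->
  (forall y1 y2, P y1 -> P y2 -> P (y1 + y2)) ->
  (forall c w, Q w -> P (c *: pword w)) -> pspan Q x -> P x.
Proof.
move=> P0 PD PW [L hL ->]; rewrite big_seq; apply: big_ind => // cw hcw.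
exact/PW/hL.
Qed.

Lemma pspanM Q1 Q2 Q x y : (forall w v, Q1 w -> Q2 v -> Q (w ++ v)) ->
  pspan Q1 x -> pspan Q2 y -> pspan Q (x * y).
Proof.
move=> h hx hy; apply: (@pspan_ind Q1 (fun u => pspan Q (u * y)) x _ _ _ hx) =>
  [|y1 y2|c w hw].
- by rewrite mul0r; exact: pspan0.
- by rewrite mulrDl; exact: pspanD.
apply: (@pspan_ind Q2 (fun u => pspan Q (c *: pword w * u)) y _ _ _ hy) =>
  [|y1 y2|b v hv].
- by rewrite mulr0; exact: pspan0.
- by rewrite mulrDr; exact: pspanD.
rewrite -scalerAl -scalerAr -pword_cat; do 2 apply: pspanZ.
exact/pspan_word/h.
Qed.

Definition homog (d l : nat) (w : seq pbw) : Prop := pdeg w = d /\ size w = l.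

Lemma pspan_gen g : pspan (homog (pbw_deg g) 1) (pbw_gen t z g).
Proof.
have -> : pbw_gen t z g = pword [:: g] by rewrite /pword big_seq1.
by apply: pspan_word; split; rewrite ?/pdeg ?big_seq1.
Qed.

Lemma pspan_t (i j : idx a n) r (h : pbw_cond (i, j)) :
  pspan (homog r 1) (t i j r.+1).
Proof. exact: (pspan_gen (inl (exist _ (i, j) h, r))). Qed.

Lemma pspan_z r : pspan (homog r 1) (z r.+1).
Proof. exact: (pspan_gen (inr r)). Qed.

Lemma pbw_reduce_gen i j r : exists2 y, pspan (homog r 1) y &
  filt r%:Z 0 (t i j r.+1 - y).
Proof.
have [hij|] := boolP (pbw_cond (i, j)).
  by exists (t i j r.+1); [exact: pspan_t|rewrite subrr; exact: filt0].
have := filt_z t0 zP i j r; set b := (i == j)%:R.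
move=> hz hij; have [hji|hji'] := boolP (pbw_cond (opp_idx j, opp_idx i)).
  exists (b *: z r.+1 - th K i j *: t (opp_idx j) (opp_idx i) r.+1).
    rewrite -scaleNr; apply: pspanD; apply: pspanZ; first exact: pspan_z.
    exact: pspan_t.
  by rewrite opprB addrA -opprB; exact: filtN.
have [eij hth] := pbw_cond_anti hij hji'.
(* The pair (i, j) is its own mirror image here and theta_ij = 1, so the relation reads 2 t_ij =
   delta_ij z up to lower terms. *)
exists ((b / 2) *: z r.+1); first exact/pspanZ/pspan_z.
move: hz; rewrite /th hth scale1r eij opp_idxK => hz.
rewrite -eij in hz *.
have -> : t i j r.+1 - (b / 2) *: z r.+1 =
    - 2^-1 *: (b *: z r.+1 - (t i j r.+1 + t i j r.+1)).
  rewrite scaleNr -scalerN opprB scalerBr scalerA [_^-1 * _]mulrC.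
  rewrite -mulr2n -scaler_nat scalerA mulVf ?scale1r //.
  by rewrite pnatr_eq0.
exact: filtZ.
Qed.

Variable i0 : idx a n.

Lemma pspan_filt d l x : pspan (homog d l) x -> filt d%:Z l%:Z x.
Proof.
move=> h; apply: (pspan_ind _ _ _ h) => //; [exact: filt0|exact: filtD|].
by move=> c w [<- <-]; apply: filtZ; exact: (filt_pword t0 zP i0).
Qed.

Lemma pbw_reduce w : exists2 y, pspan (homog (wdeg w) (size w)) y &
  filt (wdeg w)%:Z ((size w)%:Z - 1) (tword w - y).
Proof.
elim: w => [|[[i j] r] w [y hy hwy]].
  exists 1; last by rewrite [tword _]big_nil subrr; exact: filt0.
  have -> : 1 = pword [::] by rewrite /pword big_nil.
  by apply: pspan_word; split; rewrite // /pdeg /wdeg !big_nil.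
have [u hu htu] := pbw_reduce_gen i j r.
exists (u * y).
  apply: pspanM hu hy => w1 w2 [e1 f1] [e2 f2].
  by split; rewrite ?size_cat ?pdeg_cat ?f1 ?f2 ?e1 ?e2 // /wdeg big_cons.
have -> : tword ((i, j, r) :: w) = t i j r.+1 * tword w by exact: big_cons.
have -> : wdeg ((i, j, r) :: w) = (r + wdeg w)%N by rewrite /wdeg big_cons.
rewrite mulr_subE; apply: filtD; last first.
  apply: filtMZ (pspan_filt hu) hwy.
  by rewrite /below /=; move: (wdeg w) (size w) => *; lia.
apply: filtMZ htu _; last first.
  by rewrite -[tword w]scale1r; apply: filtW; exact: below_refl.
by rewrite /below /=; move: (wdeg w) (size w) => *; lia.
Qed.

Variable le : rel pbw.
Hypothesis le_total : total le.

(** Each letter is rewritten in the chosen generators, then the word is sorted; both moves leave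
    lexicographically lower errors. A word of smaller degree may be longer than [w], hence an
    induction on the length inside one on the degree. *)
Lemma pspan_sorted w : pspan (sorted le) (tword w).
Proof.
have [d] := ubnP (wdeg w); elim: d w => // d IHd w.
have [l] := ubnP (size w); elim: l w => // l IHl w; rewrite !ltnS => hl hd.
have low x : filt (wdeg w)%:Z ((size w)%:Z - 1) x -> pspan (sorted le) x.
  elim=> [|u v _ hu _ hv|c v hv]; first exact: pspan0.
    exact: pspanD.
  apply: pspanZ; have [hlt|hge] := ltnP (wdeg v) d; first exact: IHd.
  have : (size v < l)%N && (wdeg v < d.+1)%N.
    move: hv hl hd hge; rewrite /below.
    by move: (wdeg v) (wdeg w) (size v) (size w) => *; lia.
  by move=> /andP[]; exact: IHl.
have [y hy hwy] := pbw_reduce w; rewrite -(subrK y (tword w)).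
apply: pspanD; first exact: low.
apply: (pspan_ind _ _ _ hy) => [||c v [e1 e2]]; [exact: pspan0|exact: pspanD|].
apply: pspanZ; rewrite -(subrK (pword (sort le v)) (pword v)).
apply: pspanD; last by apply/pspan_word/sort_sorted.
by apply: low; rewrite -e1 -e2; apply: (filt_perm t0 rtt zP i0);
  rewrite perm_sym perm_sort.
Qed.

(** A basis expansion has its coefficients given by a function on words, so repeated words must be
    merged; the induction keeps the list duplicate-free for this purpose. *)
Lemma pspan_basis x : pspan (sorted le) x ->
  exists (s : seq {w : seq pbw | sorted le w})
    (c : {w : seq pbw | sorted le w} -> K),
    x = \sum_(i <- s) c i *: pword (val i).
Proof.
move=> [L hL ->].
suff [s [c [_ ->]]] : exists (s : seq {w : seq pbw | sorted le w})
    (c : {w : seq pbw | sorted le w} -> K), uniq s /\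
    \sum_(cw <- L) cw.1 *: pword cw.2 = \sum_(i <- s) c i *: pword (val i).
  by exists s, c.
elim: L hL => [|[b w] L IH] hL; first by exists [::], (fun=> 0); rewrite !big_nil.
have [|s [c [us es]]] := IH; first by move=> cw h; apply: hL; rewrite inE h orbT.
pose i : {w : seq pbw | sorted le w} := exist _ w (hL _ (mem_head _ _)).
rewrite big_cons es /= -[w]/(val i).
have [his|his] := boolP (i \in s).
  exists s, (fun j => c j + (if j == i then b else 0)); split=> //.
  rewrite [RHS](bigD1_seq i) //= [in LHS](bigD1_seq i) //= eqxx.
  rewrite scalerDl addrA [b *: _ + _]addrC; congr (_ + _).
  by apply: eq_bigr => j /negbTE ->; rewrite addr0.
exists (i :: s), (fun j => if j == i then b else c j); rewrite /= his us.
split=> //; rewrite big_cons eqxx; congr (_ + _); apply: eq_big_seq => j hj.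
by case: eqP his => // <-; rewrite hj.
Qed.

End SpanningPBW.

(** * Products of solutions of the RTT relation *)

Section RMatrixProduct.
Context (K : fieldType) (a : lie_type) (n : nat) (A : algType K).
Local Notation idx := (idx a n).
Local Notation ku := (kappa K a n).
Implicit Types (F G : int -> int -> A) (t : idx -> idx -> nat -> A).

(* The entry of (u - v) (u - v - kappa) R(u - v) at ((i, k), (p, q)), acting on
   a series F(u, v). *)
Definition rmx (i k p q : idx) F : int -> int -> A := fun r s =>
  ((i == p) && (k == q))%:R *: mul_uvB 0 (mul_uvB ku F) r s -
  ((k == p) && (i == q))%:R *: mul_uvB ku F r s +
  (((k == opp_idx i) && (q == opp_idx p))%:R * th K i p) *: mul_uvB 0 F r s.

Definition tt12 t (i j k l : idx) : int -> int -> A :=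
  fun r s => coefz (t i j) r * coefz (t k l) s.

Definition tt21 t (i j k l : idx) : int -> int -> A :=
  fun r s => coefz (t k l) s * coefz (t i j) r.

(** R is a symmetric matrix, which lets the same [rmx] describe its action on rows from the left and
    on columns from the right. *)
Lemma rmxC i k p q F : rmx i k p q F = rmx p q i k F.
Proof.
rewrite /rmx; apply/funext => r; apply/funext => s.
rewrite [i == p]eq_sym [k == q]eq_sym (andbC (k == p)) [k == p]eq_sym
  [i == q]eq_sym.
by rewrite (andbC (k == opp_idx i)) (@thC K).
Qed.

Lemma mul_uvBZ c b F r s :
  mul_uvB c (fun r s => b *: F r s) r s = b *: mul_uvB c F r s.
Proof. by rewrite /mul_uvB !scalerBr !scalerA mulrC. Qed.

Lemma mul_uvB_sum c (I : finType) (F : I -> int -> int -> A) r s :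
  mul_uvB c (fun r s => \sum_i F i r s) r s = \sum_i mul_uvB c (F i) r s.
Proof. by rewrite /mul_uvB scaler_sumr -!sumrB. Qed.

Lemma sum_pair_delta (F : idx -> idx -> A) i k :
  \sum_p \sum_q ((i == p) && (k == q))%:R *: F p q = F i k.
Proof.
rewrite (bigD1 i) //= (bigD1 k) //= !eqxx scale1r !big1 ?addr0 //.
  move=> p; rewrite eq_sym => /negbTE ip; apply: big1 => q _.
  by rewrite ip scale0r.
by move=> q; rewrite eq_sym => /negbTE ->; rewrite andbF scale0r.
Qed.

Lemma rmx_sum i k (F : idx -> idx -> int -> int -> A) r s :
  \sum_p \sum_q rmx i k p q (F p q) r s =
  mul_uvB 0 (mul_uvB ku (F i k)) r s - mul_uvB ku (F k i) r s +
  mul_uvB 0 (fun r s => (k == opp_idx i)%:R *: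
    \sum_p th K i p *: F p (opp_idx p) r s) r s.
Proof.
rewrite /rmx.
under eq_bigr do rewrite big_split sumrB.
rewrite big_split sumrB /= sum_pair_delta.
rewrite (sum_pair_delta (fun p q => mul_uvB ku (F p q) r s) k i).
congr (_ + _); rewrite mul_uvBZ mul_uvB_sum scaler_sumr; apply: eq_bigr => p _.
rewrite mul_uvBZ scalerA (bigD1 (opp_idx p)) //= eqxx andbT big1 ?addr0 // => q.
by move=> /negbTE ->; rewrite andbF mul0r scale0r.
Qed.

(** This is R T_1 T_2 = T_2 T_1 R with R = 1 - P / (u - v) + Q / (u - v - kappa). The identity, P
    and Q parts of the difference of the two sides are the commutator, [rtt_P] and [rtt_Q]. *)
Lemma rttE t i j k l r s : rtt_lhs t i j k l r s = rtt_rhs t i j k l r s <->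
  \sum_p \sum_q rmx i k p q (tt12 t p j q l) r s =
  \sum_p \sum_q rmx j l p q (tt21 t i p k q) r s.
Proof.
rewrite (rmx_sum i k (fun p q => tt12 t p j q l)).
rewrite (rmx_sum j l (fun p q => tt21 t i p k q)).
have eC : rtt_commutator t i j k l =
    (fun r s => tt12 t i j k l r s - tt21 t i j k l r s) by [].
have eP : rtt_P t i j k l =
    (fun r s => tt12 t k j i l r s - tt21 t i l k j r s) by [].
have eQ : rtt_Q t i j k l = (fun r s =>
    (k == opp_idx i)%:R *: (\sum_p th K i p *: tt12 t p j (opp_idx p) l r s) -
    (l == opp_idx j)%:R *: (\sum_p th K j p *: tt21 t i p k (opp_idx p) r s)) by [].
rewrite /rtt_lhs /rtt_rhs eC eP eQ mul_uvB_sub [X in _ - X]mul_uvB_sub.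
have -> : mul_uvB 0 (mul_uvB ku (fun r s => tt12 t i j k l r s -
  tt21 t i j k l r s)) r s =
   mul_uvB 0 (mul_uvB ku (tt12 t i j k l)) r s -
     mul_uvB 0 (mul_uvB ku (tt21 t i j k l)) r s.
  by rewrite -mul_uvB_sub /mul_uvB; congr (_ - _ - _); rewrite ?scale0r //;
    apply: mul_uvB_sub.
set x1 := mul_uvB 0 (mul_uvB ku (tt12 _ _ _ _ _)) r s.
set x2 := mul_uvB 0 (mul_uvB ku (tt21 _ _ _ _ _)) r s.
move: (mul_uvB ku _ r s) (mul_uvB ku _ r s) (mul_uvB 0 _ r s) (mul_uvB 0 _ r s).
move: x1 x2 => x1 x2 y2 y1 w2 w1; have sub4 (x y u v : A) : x - y - (u - v) =
  x - u - (y - v).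
  by rewrite !opprD !opprK addrACA.
have e : x1 - x2 - (y1 - y2 - (w1 - w2)) = x1 - y1 + w1 - (x2 - y2 + w2).
  rewrite [in RHS]opprD [RHS]addrACA [X in _ = X + _]sub4.
  by rewrite [X in _ + X = _]opprB [LHS]addrCA [LHS]addrC.
split=> /eqP; first by rewrite -subr_eq0 e subr_eq0 => /eqP.
by rewrite -subr_eq0 -e subr_eq0 => /eqP.
Qed.

Section Convolution.
Variable B : nat.

(* The product of two series in u^-1 and v^-1, with the exponents of the second
   factor cut off outside [-B, B]. *)
Definition conv F G : int -> int -> A := fun r s =>
  \sum_(x < (2 * B).+1) \sum_(y < (2 * B).+1)
    F (r - (x%:Z - B%:Z)) (s - (y%:Z - B%:Z)) * G (x%:Z - B%:Z) (y%:Z - B%:Z).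

Definition supported (k : int) F : Prop :=
  forall r s : int, (r < - k) || (s < - k) -> F r s = 0.

Lemma supported_mul_uvB c k F : supported k F -> supported (k + 1) (mul_uvB c F).
Proof.
move=> hF r s h; rewrite /mul_uvB !hF ?scaler0 ?subr0 //; lia.
Qed.

Lemma conv_sumL (I : finType) (F : I -> int -> int -> A) G r s :
  conv (fun r s => \sum_i F i r s) G r s = \sum_i conv (F i) G r s.
Proof.
rewrite exchange_big; apply: eq_bigr => x _; rewrite exchange_big.
by apply: eq_bigr => y _; rewrite mulr_suml.
Qed.

Lemma conv_sumR (I : finType) F (G : I -> int -> int -> A) r s :
  conv F (fun r s => \sum_i G i r s) r s = \sum_i conv F (G i) r s.
Proof.
rewrite exchange_big; apply: eq_bigr => x _; rewrite exchange_big.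
by apply: eq_bigr => y _; rewrite mulr_sumr.
Qed.

Lemma conv_addL F1 F2 G r s :
  conv (fun r s => F1 r s + F2 r s) G r s = conv F1 G r s + conv F2 G r s.
Proof.
rewrite -big_split; apply: eq_bigr => x _; rewrite -big_split.
by apply: eq_bigr => y _; rewrite mulrDl.
Qed.

Lemma conv_addR F G1 G2 r s :
  conv F (fun r s => G1 r s + G2 r s) r s = conv F G1 r s + conv F G2 r s.
Proof.
rewrite -big_split; apply: eq_bigr => x _; rewrite -big_split.
by apply: eq_bigr => y _; rewrite mulrDr.
Qed.

Lemma conv_scaleL c F G r s :
  conv (fun r s => c *: F r s) G r s = c *: conv F G r s.
Proof.
rewrite scaler_sumr; apply: eq_bigr => x _; rewrite scaler_sumr.
by apply: eq_bigr => y _; rewrite scalerAl.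
Qed.

Lemma conv_scaleR c F G r s :
  conv F (fun r s => c *: G r s) r s = c *: conv F G r s.
Proof.
rewrite scaler_sumr; apply: eq_bigr => x _; rewrite scaler_sumr.
by apply: eq_bigr => y _; rewrite scalerAr.
Qed.

Lemma conv_shiftL F G r s :
  (conv (fun r s => F (r + 1) s) G r s = conv F G (r + 1) s) *
  (conv (fun r s => F r (s + 1)) G r s = conv F G r (s + 1)).
Proof.
by split; apply: eq_bigr => x _; apply: eq_bigr => y _; congr (F _ _ * _); lia.
Qed.

Lemma sum_shift (V : zmodType) (N : nat) (f : nat -> V) :
  f 0%N = 0 -> f N = 0 -> \sum_(x < N) f x.+1 = \sum_(x < N) f x.
Proof.
move=> f0 fN; rewrite -[LHS]add0r -{1}f0.
by rewrite -(big_ord_recl N f) big_ord_recr /= fN addr0.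
Qed.

(** A shift in the second factor moves the window by one place, which is harmless if the boundary
    terms vanish: at the lower end because of the support of [G], at the upper end because of that
    of [F]. A shift in the first factor leaves the window alone. *)
Lemma conv_shiftR k k' F G r s : supported k F -> supported k' G ->
  k' < B%:Z -> r + k < B%:Z -> s + k < B%:Z ->
  (conv F (fun r s => G (r + 1) s) r s = conv F G (r + 1) s) *
  (conv F (fun r s => G r (s + 1)) r s = conv F G r (s + 1)).
Proof.
move=> hF hG kB rB sB; split.
  rewrite /conv; pose f x := \sum_(y < (2 * B).+1)
    F (r + 1 - (x%:Z - B%:Z)) (s - (y%:Z - B%:Z)) * G (x%:Z - B%:Z) (y%:Z - B%:Z).
  rewrite -[RHS](@sum_shift _ _ f).
  - apply: eq_bigr => x _; apply: eq_bigr => y _.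
    by congr (F _ _ * G _ _); lia.
  - by apply: big1 => y _; rewrite hG ?mulr0 //; lia.
  - by apply: big1 => y _; rewrite hF ?mul0r //; lia.
apply: eq_bigr => x _.
pose f y := F (r - (x%:Z - B%:Z)) (s + 1 - (y%:Z - B%:Z)) * G (x%:Z - B%:Z)
  (y%:Z - B%:Z).
rewrite -[RHS](@sum_shift _ _ f).
- by apply: eq_bigr => y _; congr (F _ _ * G _ _); lia.
- by rewrite /f hG ?mulr0 //; lia.
- by rewrite /f hF ?mul0r //; lia.
Qed.

Lemma conv_mul_uvBL c F G r s :
  conv (mul_uvB c F) G r s = mul_uvB c (conv F G) r s.
Proof.
have -> : mul_uvB c F = (fun r s => F (r + 1) s +
  ((-1) *: F r (s + 1) + (- c) *: F r s)).
  apply/funext => r'; apply/funext => s'.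
  by rewrite /mul_uvB scaleN1r scaleNr addrA.
rewrite conv_addL (conv_addL (fun r s => (-1) *: F r (s + 1))) !conv_scaleL.
by rewrite !conv_shiftL scaleN1r scaleNr addrA.
Qed.

Lemma conv_mul_uvBR c k k' F G r s : supported k F -> supported k' G ->
  k' < B%:Z -> r + k < B%:Z -> s + k < B%:Z ->
  conv F (mul_uvB c G) r s = mul_uvB c (conv F G) r s.
Proof.
move=> hF hG kB rB sB.
have -> : mul_uvB c G = (fun r s => G (r + 1) s +
  ((-1) *: G r (s + 1) + (- c) *: G r s)).
  apply/funext => r'; apply/funext => s'.
  by rewrite /mul_uvB scaleN1r scaleNr addrA.
rewrite conv_addR (conv_addR _ (fun r s => (-1) *: G r (s + 1))) !conv_scaleR.
by rewrite !(conv_shiftR hF hG) // scaleN1r scaleNr addrA.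
Qed.

Lemma conv_rmxL i k p q F G r s :
  conv (rmx i k p q F) G r s = rmx i k p q (conv F G) r s.
Proof.
rewrite /rmx; set c1 := _%:R; set c2 := _%:R; set c3 := _ * _.
have -> : (fun r s => c1 *: mul_uvB 0 (mul_uvB ku F) r s - c2 *: mul_uvB ku F r s +
   c3 *: mul_uvB 0 F r s) = (fun r s => c1 *: mul_uvB 0 (mul_uvB ku F) r s +
     ((- c2) *: mul_uvB ku F r s + c3 *: mul_uvB 0 F r s)).
  by apply/funext => r'; apply/funext => s'; rewrite scaleNr addrA.
rewrite conv_addL (conv_addL (fun r s => _ *: _)) !conv_scaleL !conv_mul_uvBL.
rewrite scaleNr addrA; congr (_ *: _ - _ + _).
by rewrite {1 3}/mul_uvB !conv_mul_uvBL.
Qed.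

Lemma conv_rmxR i k p q F G r s : supported 0 F -> supported 0 G ->
  r + 1 < B%:Z -> s + 1 < B%:Z -> 1 < B%:Z ->
  conv F (rmx i k p q G) r s = rmx i k p q (conv F G) r s.
Proof.
move=> hF hG rB sB B1.
rewrite /rmx; set c1 := _%:R; set c2 := _%:R; set c3 := _ * _.
have -> : (fun r s => c1 *: mul_uvB 0 (mul_uvB ku G) r s - c2 *: mul_uvB ku G r s +
   c3 *: mul_uvB 0 G r s) = (fun r s => c1 *: mul_uvB 0 (mul_uvB ku G) r s +
     ((- c2) *: mul_uvB ku G r s + c3 *: mul_uvB 0 G r s)).
  by apply/funext => r'; apply/funext => s'; rewrite scaleNr addrA.
have hR r' s' : r' <= r + 1 -> s' <= s + 1 ->
    conv F (mul_uvB ku G) r' s' = mul_uvB ku (conv F G) r' s'.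
  by move=> h1 h2; apply: (conv_mul_uvBR _ hF hG); lia.
rewrite conv_addR (conv_addR _ (fun r s => _ *: _)) !conv_scaleR hR; try lia.
rewrite (conv_mul_uvBR 0 hF hG); try lia.
rewrite (conv_mul_uvBR 0 hF (supported_mul_uvB ku hG)); try lia.
rewrite scaleNr addrA; congr (_ *: _ - _ + _).
by rewrite {1 3}/mul_uvB !hR //; lia.
Qed.

End Convolution.
Lemma rmx_congr i k p q F G r s :
  (forall r' s', r' <= r + 2 -> s' <= s + 2 -> F r' s' = G r' s') ->
  rmx i k p q F r s = rmx i k p q G r s.
Proof. by move=> h; rewrite /rmx /mul_uvB !h //; lia. Qed.

Lemma rmx_bigsum i k p q (I : finType) (F : I -> int -> int -> A) r s :
  rmx i k p q (fun r s => \sum_x F x r s) r s = \sum_x rmx i k p q (F x) r s.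
Proof.
rewrite /rmx big_split sumrB -!scaler_sumr !mul_uvB_sum.
congr (_ *: _ - _ + _); rewrite -mul_uvB_sum; congr (_ - _ - _ *: _).
- exact: mul_uvB_sum.
- exact: mul_uvB_sum.
- exact: mul_uvB_sum.
Qed.

Lemma rttE_pair t i j k l r s : rtt_lhs t i j k l r s = rtt_rhs t i j k l r s <->
  \sum_(p : idx * idx) rmx i k p.1 p.2 (tt12 t p.1 j p.2 l) r s =
  \sum_(p : idx * idx) rmx j l p.1 p.2 (tt21 t i p.1 k p.2) r s.
Proof.
rewrite rttE.
by rewrite -(pair_bigA _ (fun p q => rmx i k p q (tt12 t p j q l) r s))
  -(pair_bigA _ (fun p q => rmx j l p q (tt21 t i p k q) r s)).
Qed.

Lemma coefz_neg (f : nat -> A) (r : int) : r < 0 -> coefz f r = 0.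
Proof. by case: r. Qed.

Lemma coefz_smul (B : nat) (f g : nat -> A) (r : int) : r <= B%:Z ->
  coefz (smul f g) r = \sum_(x < (2 * B).+1)
    coefz f (r - (x%:Z - B%:Z)) * coefz g (x%:Z - B%:Z).
Proof.
pose h x := coefz f (r - (x%:Z - B%:Z)) * coefz g (x%:Z - B%:Z).
have h0 x : (x%:Z < B%:Z) || (r < x%:Z - B%:Z) -> h x = 0.
  rewrite /h => /orP[] hx; first by rewrite (@coefz_neg g) ?mulr0 //; lia.
  by rewrite (@coefz_neg f) ?mul0r //; lia.
case: r @h h0 => [m|m] h h0 hm /=; last by rewrite big1 // => x _; apply: h0; lia.
rewrite -(big_mkord xpredT h) (@big_cat_nat _ _ _ B) //=; last by lia.
rewrite [X in X + _]big_nat_cond [X in X + _]big1 ?add0r; last first.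
  by move=> x hx; apply: h0; lia.
rewrite (@big_cat_nat _ _ _ (m.+1 + B)) /=; try by lia.
rewrite [X in _ + X]big_nat_cond [X in _ + X]big1 ?addr0; last first.
  by move=> x hx; apply: h0; lia.
rewrite -{1}[B]add0n big_addn addnK big_mkord /smul (reindex_inj rev_ord_inj).
apply: eq_bigr => x _ /=; rewrite /h.
have hx := ltn_ord x.
have -> : (x + B)%N%:Z - B%:Z = x%:Z by lia.
have -> : m%:Z - x%:Z = (m.+1 - x.+1)%N%:Z by lia.
by congr (_ * g _); lia.
Qed.

Definition tmul t1 t2 (i j : idx) (m : nat) : A :=
  \sum_p smul (t1 i p) (t2 p j) m.

Lemma coefz_tmul (B : nat) t1 t2 i j (r : int) : r <= B%:Z ->
  coefz (tmul t1 t2 i j) r = \sum_p \sum_(x < (2 * B).+1)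
    coefz (t1 i p) (r - (x%:Z - B%:Z)) * coefz (t2 p j) (x%:Z - B%:Z).
Proof.
move=> hr; rewrite -(eq_bigr _ (fun p _ => coefz_smul (t1 i p) (t2 p j) hr)).
by case: r {hr} => m //=; rewrite big1.
Qed.

Section Product.
Variables (t1 t2 : idx -> idx -> nat -> A).
Hypothesis rtt1 : forall i j k l r s,
  rtt_lhs t1 i j k l r s = rtt_rhs t1 i j k l r s.
Hypothesis rtt2 : forall i j k l r s,
  rtt_lhs t2 i j k l r s = rtt_rhs t2 i j k l r s.
Hypothesis t12C : forall i j k l r s, t1 i j r * t2 k l s = t2 k l s * t1 i j r.

Lemma coefz_comm i j k l r s :
  coefz (t1 i j) r * coefz (t2 k l) s = coefz (t2 k l) s * coefz (t1 i j) r.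
Proof. by case: r s => r [] s //=; rewrite ?mul0r ?mulr0. Qed.

Lemma tt12_tmul (B : nat) i j k l r s : r <= B%:Z -> s <= B%:Z ->
  tt12 (tmul t1 t2) i j k l r s = \sum_(p : idx * idx)
    conv B (tt12 t1 i p.1 k p.2) (tt12 t2 p.1 j p.2 l) r s.
Proof.
move=> hr hs; rewrite /tt12 (coefz_tmul _ _ _ _ hr) (coefz_tmul _ _ _ _ hs).
rewrite -(pair_bigA _ (fun p q => conv B (tt12 t1 i p k q) (tt12 t2 p j q l) r s)).
rewrite mulr_suml; apply: eq_bigr => p _; rewrite mulr_sumr; apply: eq_bigr => q _.
rewrite mulr_suml; apply: eq_bigr => x _; rewrite mulr_sumr; apply: eq_bigr => y _.
by rewrite /tt12 -!mulrA; congr (_ * _); rewrite !mulrA coefz_comm.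
Qed.

Lemma tt21_tmul (B : nat) i j k l r s : r <= B%:Z -> s <= B%:Z ->
  tt21 (tmul t1 t2) i j k l r s = \sum_(p : idx * idx)
    conv B (tt21 t1 i p.1 k p.2) (tt21 t2 p.1 j p.2 l) r s.
Proof.
move=> hr hs; rewrite /tt21 (coefz_tmul _ _ _ _ hr) (coefz_tmul _ _ _ _ hs).
rewrite -(pair_bigA _ (fun p q => conv B (tt21 t1 i p k q) (tt21 t2 p j q l) r s)).
rewrite mulr_suml exchange_big /=; apply: eq_bigr => p _.
rewrite mulr_sumr; apply: eq_bigr => q _.
rewrite mulr_suml /conv exchange_big; apply: eq_bigr => x _.
rewrite mulr_sumr; apply: eq_bigr => y _.
by rewrite /tt21 -!mulrA; congr (_ * _); rewrite !mulrA coefz_comm.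
Qed.

Lemma supported_tt t i j k l : supported 0 (tt12 t i j k l) * supported 0
  (tt21 t i j k l).
Proof.
by split=> r s; rewrite oppr0 => /orP[] h; rewrite /tt12 /tt21 (coefz_neg _ h)
  ?mul0r ?mulr0.
Qed.

(* In matrix form the relation is R T_1 T_2 = T_2 T_1 R, which passes to products
   of commuting solutions. *)
Theorem rtt_tmul i j k l r s :
  rtt_lhs (tmul t1 t2) i j k l r s = rtt_rhs (tmul t1 t2) i j k l r s.
Proof.
(* The window must contain all exponents that the two linear factors of R can reach from (r, s),
   that is up to r + 2 and s + 2, with room for the boundary terms. *)
apply/rttE_pair; pose B := (absz r + absz s + 4)%N.
have E i' k' p' q' (F G : int -> int -> A) :
  (forall r' s', r' <= B%:Z -> s' <= B%:Z ->
    F r' s' = G r' s') -> rmx i' k' p' q' F r s = rmx i' k' p' q' G r s.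
  by move=> h; apply: rmx_congr => r' s' hr hs; apply: h; lia.
transitivity (\sum_(p : idx * idx) \sum_(m : idx * idx)
    rmx i k p.1 p.2 (conv B (tt12 t1 p.1 m.1 p.2 m.2) (tt12 t2 m.1 j m.2 l)) r s).
  apply: eq_bigr => p _; rewrite -rmx_bigsum; apply: E => r' s'.
  exact: tt12_tmul.
(* The relation for [t1] carries R from the left of both factors to the place between them. *)
transitivity (\sum_(m : idx * idx) \sum_(p : idx * idx)
    rmx m.1 m.2 p.1 p.2 (conv B (tt21 t1 i p.1 k p.2) (tt12 t2 m.1 j m.2 l)) r s).
  rewrite exchange_big; apply: eq_bigr => m _ /=.
  under eq_bigr do rewrite -conv_rmxL.
  under [RHS]eq_bigr do rewrite -conv_rmxL.
  rewrite -!conv_sumL; congr (conv B _ _ r s).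
  by apply/funext => r'; apply/funext => s'; apply/rttE_pair.
(* The relation for [t2] carries R on to the right. *)
transitivity (\sum_(m : idx * idx) \sum_(p : idx * idx)
    rmx j l m.1 m.2 (conv B (tt21 t1 i p.1 k p.2) (tt21 t2 p.1 m.1 p.2 m.2)) r s).
  rewrite exchange_big [RHS]exchange_big; apply: eq_bigr => p _ /=.
  have eR i' k' (q : idx * idx) G : supported 0 G ->
    rmx i' k' q.1 q.2 (conv B (tt21 t1 i p.1 k p.2) G) r s =
      conv B (tt21 t1 i p.1 k p.2) (rmx i' k' q.1 q.2 G) r s.
    move=> hG; rewrite conv_rmxR //; try lia.
    exact: (supported_tt t1 i p.1 k p.2).2.
  have h12 := fun m1 m2 => (supported_tt t2 m1 j m2 l).1.
  have h21 := fun m1 m2 => (supported_tt t2 p.1 m1 p.2 m2).2.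
  under eq_bigr => m _ do rewrite rmxC (eR _ _ _ _ (h12 _ _)).
  under [RHS]eq_bigr => m _ do rewrite (eR _ _ _ _ (h21 _ _)).
  rewrite -!conv_sumR; congr (conv B _ _ r s).
  by apply/funext => r'; apply/funext => s'; apply/rttE_pair.
apply: eq_bigr => m _; rewrite -rmx_bigsum; apply: E => r' s' hr hs.
by rewrite (tt21_tmul _ _ _ _ hr hs).
Qed.

End Product.
End RMatrixProduct.

(** * The vector representation *)

Section VectorSeries.
Context (a : lie_type) (n : nat) (R : comNzRingType).
Local Notation idx := (idx a n).
Variables (al ka eta : R) (ep : idx -> R).
Hypothesis ep_sqr : forall i, ep i * ep i = 1.
Hypothesis ep_opp : forall i, ep (opp_idx i) = eta * ep i.
Hypothesis eta_sqr : eta * eta = 1.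
Hypothesis ka_card : #|{: idx}|%:R = 2 * ka + 2 * eta.
Implicit Types (F : int -> int -> R) (f : idx -> R).

(** The orthogonal and symplectic cases are treated together: [ep] is a sign with theta_ij = ep_i
    ep_j, [eta] is 1 or -1 accordingly, and [sdlt] is the Gram matrix of the invariant form, equal
    to [eta] times its transpose. Then [ka_card] is the definition of kappa. *)
Definition dlt (i j : idx) : R := (i == j)%:R.
Definition sdlt (i j : idx) : R := ep i * (i == opp_idx j)%:R.

Definition unit_coef (r : int) : R := (r == 0)%:R.
(** The expansion of 1 / (u - x) in powers of u^-1. *)
Definition pole_coef (x : R) (r : int) : R := if r is Posz m.+1 then x ^+ m else 0.

(* The coefficients of the vector representation
   delta_ij - E_ji / (u - al) + theta_ij E_-i,-j / (u - al - ka). *)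
Definition vec_coef (i j : idx) (r : int) (b c : idx) : R :=
  dlt i j * unit_coef r * dlt b c - dlt j b * pole_coef al r * dlt i c +
  sdlt i b * pole_coef (al + ka) r * sdlt j c.

Lemma dltC i j : dlt i j = dlt j i.
Proof. by rewrite /dlt eq_sym. Qed.

Lemma eq_opp_idx (i j : idx) : (i == opp_idx j) = (opp_idx i == j).
Proof. by rewrite -{1}(opp_idxK i) (inj_eq (inv_inj (@opp_idxK a n))). Qed.

Lemma sdltC i j : sdlt i j = eta * sdlt j i.
Proof.
rewrite /sdlt [j == _]eq_opp_idx [opp_idx j == _]eq_sym.
case: eqP => [->|]; last by rewrite !mulr0.
by rewrite ep_opp !mulr1.
Qed.

Lemma sum_dlt i f : \sum_p dlt i p * f p = f i.
Proof.
rewrite (bigD1 i) //= big1 ?addr0 /dlt ?eqxx ?mul1r // => p.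
by rewrite eq_sym => /negbTE ->; rewrite mul0r.
Qed.

Lemma sum_sdlt i f : \sum_p sdlt i p * f p = ep i * f (opp_idx i).
Proof.
rewrite -(sum_dlt (opp_idx i) f) mulr_sumr; apply: eq_bigr => p _.
by rewrite /sdlt /dlt mulrA eq_opp_idx.
Qed.

Definition vec_prod (i j k l b d : idx) : int -> int -> R := fun r s =>
  \sum_c vec_coef i j r b c * vec_coef k l s c d.

Lemma sum_sdlt2 j k : \sum_x sdlt j x * sdlt k x = dlt j k.
Proof.
rewrite sum_sdlt /sdlt opp_idxK /dlt eq_sym; case: eqP => [->|];
  last by rewrite !mulr0.
by rewrite mulr1 ep_sqr.
Qed.

(** The nine products of the three terms of each factor. The inner sums collapse because the rows of
    [sdlt] are orthonormal, as are those of [dlt]. *)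
Lemma vec_prodE i j k l b d r s :
  let e := unit_coef in let p := pole_coef al in let q := pole_coef (al + ka) in
  vec_prod i j k l b d r s =
  dlt i j * dlt k l * dlt b d * (e r * e s)
  - dlt i j * dlt b l * dlt k d * (e r * p s)
  + dlt i j * sdlt k b * sdlt l d * (e r * q s)
  - dlt j b * dlt i d * dlt k l * (p r * e s)
  + dlt j b * dlt i l * dlt k d * (p r * p s)
  - dlt j b * sdlt k i * sdlt l d * (p r * q s)
  + sdlt i b * sdlt j d * dlt k l * (q r * e s)
  - sdlt i b * sdlt j l * dlt k d * (q r * p s)
  + sdlt i b * dlt j k * sdlt l d * (q r * q s).
Proof.
move=> e p q; rewrite /vec_prod.
pose A := dlt i j * e r; pose B := dlt j b * p r; pose C := sdlt i b * q r.
pose A' := dlt k l * e s; pose B' := dlt k d * p s; pose C' := sdlt l d * q s.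
have -> : \sum_c vec_coef i j r b c * vec_coef k l s c d =
  A * A' * (\sum_c dlt b c * dlt d c) - A * B' * (\sum_c dlt b c * dlt l c)
  + A * C' * (\sum_c dlt b c * sdlt k c) - B * A' * (\sum_c dlt i c * dlt d c)
  + B * B' * (\sum_c dlt i c * dlt l c) - B * C' * (\sum_c dlt i c * sdlt k c)
  + C * A' * (\sum_c sdlt j c * dlt d c) - C * B' * (\sum_c sdlt j c * dlt l c)
  + C * C' * (\sum_c sdlt j c * sdlt k c).
  rewrite !mulr_sumr -!(big_split, sumrB) /=; apply: eq_bigr => c _.
  by rewrite /vec_coef (dltC c d) -/e -/p -/q /A /B /C /A' /B' /C'; ring.
rewrite !sum_dlt sum_sdlt2.
have -> : \sum_c sdlt j c * dlt d c = sdlt j d.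
  by under eq_bigr do rewrite mulrC; rewrite sum_dlt.
have -> : \sum_c sdlt j c * dlt l c = sdlt j l.
  by under eq_bigr do rewrite mulrC; rewrite sum_dlt.
by rewrite /= (dltC d b) (dltC l b) (dltC d i) (dltC l i) /A /B /C /A' /B' /C';
  ring.
Qed.

Lemma dlt_oppl i j : dlt (opp_idx i) j = dlt i (opp_idx j).
Proof. by rewrite /dlt eq_opp_idx. Qed.

Lemma sdltE i j : sdlt i j = ep i * dlt i (opp_idx j).
Proof. by []. Qed.

Lemma ep_sdlt_opp i j : ep i * sdlt (opp_idx i) j = eta * dlt i j.
Proof. by rewrite sdltE dlt_oppl opp_idxK ep_opp -[RHS]mul1r -(ep_sqr i); ring. Qed.

Lemma sum_ep_dlt j f : \sum_p ep p * dlt p j * f p = ep j * f j.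
Proof.
rewrite -(sum_dlt j (fun p => ep p * f p)); apply: eq_bigr => p _.
by rewrite (dltC p j) mulrAC mulrC.
Qed.

Lemma sum_ep_sdlt b f : \sum_p ep p * sdlt p b * f p = f (opp_idx b).
Proof.
rewrite -(sum_dlt (opp_idx b) f); apply: eq_bigr => p _.
by rewrite sdltE mulrA ep_sqr mul1r dltC.
Qed.

Lemma sum_ep_loop : \sum_p ep p * sdlt (opp_idx p) p = eta * #|{: idx}|%:R.
Proof.
rewrite -sum1_card natr_sum mulr_sumr; apply: eq_bigr => p _.
by rewrite ep_sdlt_opp /dlt eqxx.
Qed.

Let N : R := #|{: idx}|%:R.

(** The contraction closes one loop, which contributes eta N; this is how the dimension enters the
    relation. *)
Lemma vec_contract_rows j l b d r s :
  let e := unit_coef in let p := pole_coef al in let q := pole_coef (al + ka) in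
  \sum_x ep x * vec_prod x j (opp_idx x) l b d r s =
  dlt b d * sdlt j l * (e r * e s - q r * p s) +
  dlt b l * sdlt j d * (q r * e s - e r * p s) +
  dlt j b * (sdlt l d * (eta * (e r * q s) + p r * p s - eta * N * (p r * q s) +
                         q r * q s) - sdlt d l * (p r * e s)).
Proof.
move=> e p q.
have -> : \sum_x ep x * vec_prod x j (opp_idx x) l b d r s =
  (\sum_x ep x * dlt x j * dlt x (opp_idx l)) * (dlt b d * (e r * e s))
  - (\sum_x ep x * dlt x j * dlt x (opp_idx d)) * (dlt b l * (e r * p s))
  + (\sum_x ep x * dlt x j * sdlt (opp_idx x) b) * (sdlt l d * (e r * q s))
  - (\sum_x ep x * dlt x d * dlt x (opp_idx l)) * (dlt j b * (p r * e s))
  + (\sum_x ep x * dlt x l * dlt x (opp_idx d)) * (dlt j b * (p r * p s))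
  - (\sum_x ep x * sdlt (opp_idx x) x) * (dlt j b * sdlt l d * (p r * q s))
  + (\sum_x ep x * sdlt x b * dlt x (opp_idx l)) * (sdlt j d * (q r * e s))
  - (\sum_x ep x * sdlt x b * dlt x (opp_idx d)) * (sdlt j l * (q r * p s))
  + (\sum_x ep x * sdlt x b * dlt x (opp_idx j)) * (sdlt l d * (q r * q s)).
  rewrite !mulr_suml -!(big_split, sumrB) /=; apply: eq_bigr => x _.
  rewrite vec_prodE -/e -/p -/q !dlt_oppl (dltC j (opp_idx x)) dlt_oppl.
  by ring.
rewrite !sum_ep_dlt !sum_ep_sdlt sum_ep_loop -!sdltE ep_sdlt_opp.
by rewrite !dlt_oppl !opp_idxK (dltC b j) -/N; ring.
Qed.

Lemma vec_contract_cols i k b d r s :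
  let e := unit_coef in let p := pole_coef al in let q := pole_coef (al + ka) in
  \sum_x ep x * vec_prod k (opp_idx x) i x b d s r =
  dlt b d * sdlt i k * (e r * e s - q r * p s) +
  dlt k d * sdlt i b * (q r * e s - e r * p s) +
  dlt i d * (sdlt k b * (eta * (e r * q s) + p r * p s - eta * N * (p r * q s) +
                         q r * q s) - sdlt b k * (p r * e s)).
Proof.
move=> e p q.
have -> : \sum_x ep x * vec_prod k (opp_idx x) i x b d s r =
  (\sum_x ep x * dlt x i * dlt x (opp_idx k)) * (dlt b d * (e s * e r))
  - (\sum_x ep x * dlt x b * dlt x (opp_idx k)) * (dlt i d * (e s * p r))
  + (\sum_x ep x * sdlt x d * dlt x (opp_idx k)) * (sdlt i b * (e s * q r))
  - (\sum_x ep x * dlt x i * dlt x (opp_idx b)) * (dlt k d * (p s * e r))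
  + (\sum_x ep x * dlt x k * dlt x (opp_idx b)) * (dlt i d * (p s * p r))
  - (\sum_x ep x * sdlt x d * dlt x (opp_idx b)) * (sdlt i k * (p s * q r))
  + (\sum_x ep x * dlt x i * sdlt (opp_idx x) d) * (sdlt k b * (q s * e r))
  - (\sum_x ep x * sdlt (opp_idx x) x) * (sdlt k b * dlt i d * (q s * p r))
  + (\sum_x ep x * sdlt x d * dlt x (opp_idx i)) * (sdlt k b * (q s * q r)).
  rewrite !mulr_suml -!(big_split, sumrB) /=; apply: eq_bigr => x _.
  rewrite vec_prodE -/e -/p -/q (dltC k (opp_idx x)) !dlt_oppl (dltC k x)
    (dltC i x) (dltC b x).
  by ring.
rewrite !sum_ep_dlt !sum_ep_sdlt sum_ep_loop -!sdltE ep_sdlt_opp.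
by rewrite !dlt_oppl !opp_idxK (dltC d k) (dltC d b) (dltC d i) -/N; ring.
Qed.

Definition mul_uvBr (c : R) F : int -> int -> R :=
  fun r s => F (r + 1) s - F r (s + 1) - c * F r s.

Lemma vec_commutatorE i j k l b d r s :
  let p := pole_coef al in let q := pole_coef (al + ka) in
  vec_prod i j k l b d r s - vec_prod k l i j b d s r =
  (dlt j b * dlt i l * dlt k d - dlt l b * dlt j k * dlt i d) * (p r * p s) +
  (sdlt i b * sdlt l d * dlt j k - sdlt k b * sdlt j d * dlt i l) * (q r * q s) +
  (sdlt k b * sdlt l j * dlt i d - sdlt k i * sdlt l d * dlt j b) * (p r * q s) +
  (sdlt i k * sdlt j d * dlt l b - sdlt i b * sdlt j l * dlt k d) * (q r * p s).
Proof.
move=> p q; rewrite !vec_prodE -/p -/q (dltC k j) (dltC b j) (dltC b l) (dltC l i).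
by ring.
Qed.

Lemma vec_exchangeE i j k l b d r s :
  let e := unit_coef in let p := pole_coef al in let q := pole_coef (al + ka) in
  vec_prod k j i l b d r s - vec_prod k j i l b d s r =
  (dlt j b * dlt i l * dlt k d - dlt l b * dlt j k * dlt i d) *
    (e r * p s - p r * e s) +
  (sdlt i b * sdlt l d * dlt j k - sdlt k b * sdlt j d * dlt i l) *
    (e r * q s - q r * e s) +
  (sdlt k b * sdlt j l * dlt i d - sdlt i k * sdlt l d * dlt j b) *
    (p r * q s - q r * p s).
Proof.
move=> e p q; rewrite !vec_prodE -/p -/q -/e (dltC k j) (dltC b l).
by ring.
Qed.

Lemma vec_contractE i j k l b d r s :
  let e := unit_coef in let p := pole_coef al in let q := pole_coef (al + ka) in
  sdlt i k * (\sum_x ep x * vec_prod x j (opp_idx x) l b d r s) -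
  sdlt j l * (\sum_x ep x * vec_prod k (opp_idx x) i x b d s r) =
  (sdlt i k * sdlt j d * dlt l b - sdlt i b * sdlt j l * dlt k d) *
    (q r * e s - e r * p s) +
  (sdlt i k * sdlt l d * dlt j b - sdlt k b * sdlt j l * dlt i d) *
    (eta * (e r * q s) + p r * p s - eta * N * (p r * q s) + q r * q s -
     eta * (p r * e s)).
Proof.
move=> e p q; rewrite vec_contract_rows vec_contract_cols -/p -/q -/e.
by rewrite (dltC b l) (sdltC d l) (sdltC b k); ring.
Qed.

Lemma pole_coefS x r : pole_coef x (r + 1) = x * pole_coef x r + unit_coef r.
Proof.
case: r => [[|m]|[|m]] /=; rewrite /unit_coef /= ?mulr0 ?add0r ?addr0 ?expr0 //.
by rewrite addn1 /= -exprS.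
Qed.

(** By [pole_coefS], (u - x) times 1 / (u - x) is 1; eliminating the shifted coefficients in this
    way leaves a polynomial identity. The loop term eta N of the contraction is balanced by the
    value 2 eta kappa + 2. *)
Lemma vec_rtt i j k l b d r s :
  mul_uvBr 0 (mul_uvBr ka (fun r s =>
    vec_prod i j k l b d r s - vec_prod k l i j b d s r)) r s =
  mul_uvBr ka (fun r s => vec_prod k j i l b d r s - vec_prod k j i l b d s r) r s -
  mul_uvBr 0 (fun r s =>
    sdlt i k * (\sum_x ep x * vec_prod x j (opp_idx x) l b d r s) -
    sdlt j l * (\sum_x ep x * vec_prod k (opp_idx x) i x b d s r)) r s.
Proof.
have eN : eta * N = 2 * eta * ka + 2.
  by rewrite /N ka_card -[X in _ = _ + X]mulr1 -eta_sqr; ring.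
rewrite /mul_uvBr !vec_commutatorE !vec_exchangeE !vec_contractE eN.
rewrite (sdltC l j) (sdltC k i) !pole_coefS.
set p1 := pole_coef al r; set p2 := pole_coef al s.
set q1 := pole_coef _ r; set q2 := pole_coef _ s.
set e0 := unit_coef r; set e1 := unit_coef (r + 1); set e2 := unit_coef (r + 1 + 1).
set f0 := unit_coef s; set f1 := unit_coef (s + 1); set f2 := unit_coef (s + 1 + 1).
by ring.
Qed.

End VectorSeries.

(** * Matrices over a polynomial ring as an algebra over the ground field *)

Definition matalg (K : fieldType) (B : algType K) (m : nat) : Type :=
  'M[{poly B}]_m.+1.

Section MatrixAlgebra.
Context (K : fieldType) (B : algType K) (m : nat).
Local Notation A := (matalg B m).

HB.instance Definition _ := GRing.NzRing.on A.

(** Matrices over [{poly B}] are scaled by [{poly B}]; the alias [matalg] carries instead the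
    scaling by [K], through constant polynomials, that linear maps out of the extended Yangian have
    to respect. *)
Definition matalg_scale (c : K) (M : A) : A := ((c%:A : B)%:P : {poly B}) *: M.

Lemma matalg_scaleA b c M :
  matalg_scale b (matalg_scale c M) = matalg_scale (b * c) M.
Proof.
by rewrite /matalg_scale scalerA -polyCM -scalerAl mul1r scalerA.
Qed.

Lemma matalg_scale1 : left_id 1 matalg_scale.
Proof. by move=> M; rewrite /matalg_scale !scale1r. Qed.

Lemma matalg_scaleDr : right_distributive matalg_scale +%R.
Proof. by move=> c M N; rewrite /matalg_scale scalerDr. Qed.

Lemma matalg_scaleDl M : {morph matalg_scale^~ M : b c / b + c}.
Proof. by move=> b c; rewrite /matalg_scale scalerDl polyCD scalerDl. Qed.

HB.instance Definition _ := GRing.Zmodule_isLmodule.Build K A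
  matalg_scaleA matalg_scale1 matalg_scaleDr matalg_scaleDl.

Lemma matalg_scaleAl c (M N : A) : c *: (M * N) = (c *: M) * N.
Proof. exact: scalemxAl. Qed.

HB.instance Definition _ :=
  GRing.Lmodule_isLalgebra.Build K A matalg_scaleAl.

Lemma matalg_scaleE c (M : A) x y : (c *: M) x y = (c%:A : B)%:P * M x y.
Proof. by rewrite mxE. Qed.

Lemma matalg_scaleAr c (M N : A) : c *: (M * N) = M * (c *: N).
Proof.
apply/matrixP => x y; rewrite matalg_scaleE !mxE mulr_sumr.
apply: eq_bigr => w _; rewrite matalg_scaleE !mulrA; congr (_ * _).
apply/polyP => k; rewrite coefCM coefMC -scalerAl -scalerAr mul1r.
by rewrite mulr1.
Qed.

HB.instance Definition _ :=
  GRing.Lalgebra_isAlgebra.Build K A matalg_scaleAr.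

End MatrixAlgebra.

Definition sgn_sym (a : lie_type) (i : int) : int :=
  if a is Symplectic then sgz i else 1.

Definition eta_sym (a : lie_type) : int := if a is Symplectic then - 1 else 1.

Lemma card_idx (a : lie_type) (n : nat) : #|{: idx a n}| = dimN a n.
Proof.
have inj : injective (fun k : nat => k%:Z - n%:Z) by move=> k l /=; lia.
have u : uniq (indices a n) by rewrite filter_uniq // map_inj_uniq ?iota_uniq.
rewrite card_seq_sub // size_filter.
have e0 : count (pred1 0) [seq k%:Z - n%:Z | k <- iota 0 (2 * n).+1] = 1.
  rewrite count_uniq_mem ?map_inj_uniq ?iota_uniq //.
  suff -> : 0 \in [seq k%:Z - n%:Z | k <- iota 0 (2 * n).+1] by [].
  by apply/mapP; exists n; rewrite ?mem_iota ?subrr //; lia.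
case: a {u} => /=.
- by rewrite count_predT size_map size_iota.
- have := count_predC (pred1 0) [seq k%:Z - n%:Z | k <- iota 0 (2 * n).+1].
  by rewrite e0 size_map size_iota add1n => -[].
- have := count_predC (pred1 0) [seq k%:Z - n%:Z | k <- iota 0 (2 * n).+1].
  by rewrite e0 size_map size_iota add1n => -[].
Qed.

(** * The vector representation as a matrix solution with a variable pole *)

Section VectorRepresentation.
Context (K : numFieldType) (a : lie_type) (n m : nat).
Local Notation idx := (idx a n).
Local Notation ku := (kappa K a n).
Variable un : 'I_m.+1 -> idx.
Hypothesis un_bij : bijective un.
Local Notation P := {poly K^o}.
Local Notation A := (matalg K^o m).

Definition sgn_idx (i : idx) : P := (sgn_sym a (val i))%:~R.

Lemma sgn_idx_sqr i : sgn_idx i * sgn_idx i = 1.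
Proof.
rewrite /sgn_idx -intrM (_ : _ * _ = 1) //.
have := valP i; rewrite mem_indices => /andP[_].
move: (val i) => i'; case: (a) => //= hi.
by rewrite mulz_sg hi.
Qed.

Lemma sgn_idx_opp i : sgn_idx (opp_idx i) = (eta_sym a)%:~R * sgn_idx i.
Proof.
rewrite /sgn_idx -intrM /=; congr _%:~R.
by move: (val i) => i'; case: (a) => //=; rewrite sgzN mulN1r.
Qed.

Lemma eta_sym_sqr : (eta_sym a)%:~R * (eta_sym a)%:~R = 1 :> P.
Proof. by rewrite -intrM; case: (a). Qed.

Lemma card_idx_kappa :
  #|{: idx}|%:R = 2 * (ku%:P : P) + 2 * (eta_sym a)%:~R :> P.
Proof.
have e : (dimN a n)%:R = 2 * ku + 2 * (eta_sym a)%:~R :> K.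
  by rewrite /kappa; case: (a) => /=; field.
rewrite card_idx -polyC_natr e polyCD !polyCM polyC_natr; congr (_ + _ * _).
exact: (rmorph_int (@polyC K^o)).
Qed.

Lemma th_sgn i j : (th K i j)%:P = sgn_idx i * sgn_idx j :> P.
Proof.
rewrite /th /sgn_idx -intrM [LHS](rmorph_int (@polyC K^o)).
by congr _%:~R; rewrite /theta /sgn_sym; move: (val i) (val j) => ? ?; case: (a).
Qed.

Local Notation vc := (vec_coef ('X : P) (ku%:P) sgn_idx).

Definition vec_rep (i j : idx) (r : nat) : A :=
  \matrix_(x, y) vc i j r%:Z (un x) (un y).

Lemma coefz_vec_rep i j r x y : coefz (vec_rep i j) r x y = vc i j r (un x) (un y).
Proof.
case: r => r /=; first by rewrite mxE.
by rewrite mxE /vec_coef /unit_coef /= !(mulr0, mul0r) subrr addr0.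
Qed.

Lemma vec_rep_prod i j k l r s x y :
  (coefz (vec_rep i j) r * coefz (vec_rep k l) s) x y =
  vec_prod 'X ku%:P sgn_idx i j k l (un x) (un y) r s.
Proof.
rewrite mxE /vec_prod (reindex un); last exact: onW_bij.
by apply: eq_bigr => w _; rewrite !coefz_vec_rep.
Qed.

Lemma vec_rep_scale c (M : A) x y : (c *: M) x y = (c%:P : P) * M x y.
Proof. by rewrite matalg_scaleE -[(c%:A : K^o)%:P]/((c * 1)%:P) mulr1. Qed.

Lemma vec_rep_sub (M N : A) x y : (M - N) x y = M x y - N x y.
Proof. by rewrite !mxE. Qed.

Lemma matalg_mul_uvB c (F : int -> int -> A) r s x y :
  mul_uvB c F r s x y = mul_uvBr (c%:P : P) (fun r s => F r s x y) r s.
Proof. by rewrite /mul_uvB !vec_rep_sub vec_rep_scale. Qed.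

Lemma vec_rep_contract (b : bool) i (M : idx -> A) x y :
  (b%:R *: \sum_p th K i p *: M p) x y =
  b%:R * sgn_idx i * \sum_p sgn_idx p * M p x y.
Proof.
rewrite vec_rep_scale polyC_natr -mulrA; congr (_ * _).
rewrite summxE mulr_sumr; apply: eq_bigr => p _.
by rewrite vec_rep_scale th_sgn mulrA.
Qed.

Lemma vec_rep_rtt i j k l r s :
  rtt_lhs vec_rep i j k l r s = rtt_rhs vec_rep i j k l r s.
Proof.
apply/matrixP => x y.
have := vec_rtt 'X sgn_idx_sqr sgn_idx_opp eta_sym_sqr card_idx_kappa
  i j k l (un x) (un y) r s.
rewrite -(polyC0 K^o) /rtt_lhs matalg_mul_uvB /rtt_rhs vec_rep_sub.
rewrite !matalg_mul_uvB => e.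
have eC : (fun r s => mul_uvB ku (rtt_commutator vec_rep i j k l) r s x y) =
    mul_uvBr (ku%:P : P) (fun r s =>
      vec_prod 'X ku%:P sgn_idx i j k l (un x) (un y) r s -
      vec_prod 'X ku%:P sgn_idx k l i j (un x) (un y) s r).
  apply/funext => r'; apply/funext => s'; rewrite matalg_mul_uvB.
  congr (mul_uvBr _ _ r' s'); apply/funext => r2; apply/funext => s2.
  by rewrite /rtt_commutator vec_rep_sub !vec_rep_prod.
rewrite eC e; congr (_ - _).
  congr (mul_uvBr _ _ r s); apply/funext => r'; apply/funext => s'.
  by rewrite /rtt_P vec_rep_sub !vec_rep_prod.
congr (mul_uvBr _ _ r s); apply/funext => r'; apply/funext => s'.
rewrite /rtt_Q vec_rep_sub !vec_rep_contract /sdlt.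
rewrite [k == _]eq_opp_idx [opp_idx k == _]eq_sym [l == _]eq_opp_idx
  [opp_idx l == _]eq_sym.
rewrite [_%:R * sgn_idx i]mulrC [_%:R * sgn_idx j]mulrC.
by congr (_ * _ - _ * _); apply: eq_bigr => p _; rewrite vec_rep_prod.
Qed.

Lemma vec_rep0 i j : vec_rep i j 0 = (i == j)%:R.
Proof.
apply/matrixP => x y; rewrite mxE /vec_coef /unit_coef /pole_coef /=.
rewrite !(mulr0, mul0r) subr0 addr0 mulr1 /dlt (bij_eq un_bij).
by case: (i == j); rewrite ?mul1r ?mul0r ?mxE.
Qed.

Lemma vec_repE i j r x y : vec_rep i j r.+1 x y =
  (th K i j *+ ((i == opp_idx (un x)) && (j == opp_idx (un y))))%:P *
    ('X + ku%:P) ^+ r -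
  ((((j == un x) && (i == un y))%:R : K^o)%:P : P) * 'X^r.
Proof.
rewrite mxE /vec_coef /unit_coef /= mulr0 mul0r sub0r addrC /dlt /sdlt.
by case: (j == un x); case: (i == un y); case: (i == opp_idx (un x));
  case: (j == opp_idx (un y)); rewrite /= ?mulr1n ?mulr0n ?th_sgn ?polyC0
    ?polyC1; ring.
Qed.

Lemma size_shifted_Xn (c : K^o) r : size (('X + c%:P) ^+ r) = r.+1.
Proof. by rewrite -[c]opprK polyCN size_exp_XsubC. Qed.

(** The image of t_ij^(r+1) has degree at most r in x, so x can be given weight 1 in the
    filtration. *)
Lemma coef_vec_rep_gt i j r k x y : (r < k)%N -> (vec_rep i j r.+1 x y)`_k = 0.
Proof.
move=> h; rewrite vec_repE coefB !coefCM coefXn gtn_eqF // mulr0 subr0.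
by rewrite [X in _ * X]nth_default ?mulr0 // size_shifted_Xn.
Qed.

(** (x + kappa)^r is monic, so kappa disappears from the top coefficient. *)
Lemma coef_vec_rep_top i j r x y : (vec_rep i j r.+1 x y)`_r =
  th K i j *+ ((i == opp_idx (un x)) && (j == opp_idx (un y))) -
  ((j == un x) && (i == un y))%:R.
Proof.
rewrite vec_repE coefB !coefCM coefXn eqxx mulr1.
have : ('X + ku%:P : P) ^+ r \is monic by rewrite monic_exp // -[ku]opprK polyCN
  monicXsubC.
by move/monicP; rewrite /lead_coef size_shifted_Xn => ->; rewrite mulr1.
Qed.

End VectorRepresentation.

(** * Constant matrices and extension of scalars *)

Section ScalarExtension.
Context (K : fieldType) (X : algType K) (m : nat).

Definition matalg_ext (M : matalg K^o m) : matalg X m :=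
  map_mx (map_poly (in_alg X)) M.

Lemma matalg_ext_is_zmod_morphism : zmod_morphism matalg_ext.
Proof. exact: map_mxB. Qed.

Lemma matalg_ext_is_monoid_morphism : monoid_morphism matalg_ext.
Proof. by split; [exact: map_mx1|exact: map_mxM]. Qed.

HB.instance Definition _ := GRing.isZmodMorphism.Build
  (matalg K^o m) (matalg X m) matalg_ext matalg_ext_is_zmod_morphism.
HB.instance Definition _ := GRing.isMonoidMorphism.Build
  (matalg K^o m) (matalg X m) matalg_ext matalg_ext_is_monoid_morphism.

Lemma coef_matalg_ext M x y k : (matalg_ext M x y)`_k = (M x y)`_k *: 1.
Proof. by rewrite mxE coef_map. Qed.

Lemma matalg_extZ c M : matalg_ext (c *: M) = c *: matalg_ext M.
Proof.
apply/matrixP => x y; apply/polyP => k.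
rewrite coef_matalg_ext !matalg_scaleE !coefCM coef_matalg_ext.
by rewrite -[RHS]scalerAl mul1r -[(c%:A : K^o)]/(c * 1) mulr1 -scalerA.
Qed.

Definition matalg_const (x : X) : matalg X m := (x%:P)%:M.

Lemma matalg_const_is_zmod_morphism : zmod_morphism matalg_const.
Proof. by move=> x y; rewrite /matalg_const polyCB raddfB. Qed.

Lemma matalg_const_is_monoid_morphism : monoid_morphism matalg_const.
Proof.
by split=> // x y; rewrite /matalg_const polyCM; exact: scalar_mxM.
Qed.

HB.instance Definition _ := GRing.isZmodMorphism.Build
  X (matalg X m) matalg_const matalg_const_is_zmod_morphism.
HB.instance Definition _ := GRing.isMonoidMorphism.Build
  X (matalg X m) matalg_const matalg_const_is_monoid_morphism.

Lemma matalg_constZ c x : matalg_const (c *: x) = c *: matalg_const x.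
Proof.
apply/matrixP => i j; rewrite matalg_scaleE !mxE mulrnAr; congr (_ *+ _).
by rewrite -polyCM -scalerAl mul1r.
Qed.

Lemma matalg_constM x (M : matalg X m) i j :
  (matalg_const x * M) i j = x%:P * M i j.
Proof. by rewrite -[LHS]/((x%:P%:M *m M) i j) mul_scalar_mx mxE. Qed.

Lemma matalg_Mconst x (M : matalg X m) i j :
  (M * matalg_const x) i j = M i j * x%:P.
Proof.
rewrite mxE (bigD1 j) //= mxE eqxx mulr1n big1 ?addr0 // => k /negbTE kj.
by rewrite mxE kj mulr0.
Qed.

(** One factor is a scalar matrix and the other has entries with coefficients in K, so they commute
    like the two factors of a tensor product. This is the hypothesis [t12C] of [rtt_tmul]. *)
Lemma matalg_const_ext x M :
  matalg_const x * matalg_ext M = matalg_ext M * matalg_const x.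
Proof.
apply/matrixP => i j; apply/polyP => k.
rewrite matalg_constM matalg_Mconst coefCM coefMC coef_matalg_ext.
by rewrite -scalerAr -scalerAl mulr1 mul1r.
Qed.

End ScalarExtension.

(** * Homomorphisms out of the extended Yangian *)

Section ScalarSolutions.
Context (K : fieldType) (a : lie_type) (n : nat) (A : algType K).
Variable f : nat -> A.
Hypothesis fC : forall r s, f r * f s = f s * f r.

Definition scal_rep (i j : idx a n) (r : nat) : A := (i == j)%:R * f r.

Lemma coefz_scal_rep i j r : coefz (scal_rep i j) r = (i == j)%:R * coefz f r.
Proof. by case: r => r //=; rewrite mulr0. Qed.

Lemma coefz_comm_self r s : coefz f r * coefz f s = coefz f s * coefz f r.
Proof. by case: r s => r [] s //=; rewrite ?mul0r ?mulr0. Qed.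

Lemma scal_rep_mul i j k l r s :
  coefz (scal_rep i j) r * coefz (scal_rep k l) s =
  (i == j)%:R * (k == l)%:R * (coefz f r * coefz f s).
Proof.
rewrite !coefz_scal_rep.
by case: (i == j); case: (k == l); rewrite ?mul0r ?mulr0 ?mul1r ?mul0r.
Qed.

(** The commutator and P vanish since the coefficients of f commute. In Q both contractions reduce
    to the same multiple of theta_ij f(u) f(v) and cancel. *)
Lemma scal_rep_rtt i j k l r s :
  rtt_lhs scal_rep i j k l r s = rtt_rhs scal_rep i j k l r s.
Proof.
have eC : rtt_commutator scal_rep i j k l = fun _ _ => 0.
  apply/funext => r'; apply/funext => s'; rewrite /rtt_commutator !scal_rep_mul.
  by rewrite (coefz_comm_self s') -!natrM mulnC subrr.
have eP : rtt_P scal_rep i j k l = fun _ _ => 0.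
  apply/funext => r'; apply/funext => s'; rewrite /rtt_P !scal_rep_mul.
  by rewrite (coefz_comm_self s') subrr.
have eQ : rtt_Q scal_rep i j k l = fun _ _ => 0.
  apply/funext => r'; apply/funext => s'; rewrite /rtt_Q.
  under eq_bigr do rewrite scal_rep_mul.
  under [X in _ - _ *: X]eq_bigr do rewrite scal_rep_mul.
  rewrite (bigD1 j) //= [X in _ - _ *: X](bigD1 i) //= !eqxx.
  rewrite [\sum_(p | p != j) _]big1 ?addr0; last first.
    by move=> p hp; rewrite (negbTE hp) !mul0r scaler0.
  rewrite [\sum_(p | p != i) _]big1 ?addr0; last first.
    by move=> p hp; rewrite [i == p]eq_sym (negbTE hp) mulr0 mul0r scaler0.
  rewrite !mul1r mulr1 (thC K j i) [opp_idx j == l]eq_sym (coefz_comm_self s').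
  by case: (k == _); case: (l == _);
    rewrite ?scale0r ?scale1r ?mul0r ?mul1r ?scaler0 ?subrr ?subr0.
have u0 c : mul_uvB c (fun _ _ => 0 : A) = fun _ _ => 0.
  by apply/funext => r'; apply/funext => s'; rewrite /mul_uvB scaler0 !subr0.
by rewrite /rtt_lhs /rtt_rhs eC eP eQ !u0 subr0.
Qed.

End ScalarSolutions.

Section Lift.
Context (K : fieldType) (a : lie_type) (n : nat) (A : algType K).
Variable T : idx a n -> idx a n -> nat -> A.
Hypothesis T0 : forall i j, T i j 0 = (i == j)%:R.
Hypothesis T_rtt : forall i j k l r s,
  rtt_lhs T i j k l r s = rtt_rhs T i j k l r s.

Definition monom_lift (k : {fmonom gen a n}) : A :=
  \prod_(g <- k) T g.1.1 g.1.2 g.2.+1.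

Lemma monom_lift_mmorphism : mmorphism monom_lift.
Proof.
split; last by rewrite /monom_lift fm1 big_nil.
by move=> k l; rewrite /monom_lift fmM big_cat.
Qed.

HB.instance Definition _ :=
  isMultiplicative.Build {fmonom gen a n} A monom_lift monom_lift_mmorphism.

Definition free_lift : free_alg K a n -> A := mmap (in_alg A) monom_lift.

HB.instance Definition _ := GRing.Additive.on free_lift.

Lemma free_lift_is_monoid_morphism : monoid_morphism free_lift.
Proof.
have [h1 h2] : multiplicative free_lift; last by split.
apply: commr_mmap_is_multiplicative => g k k'.
by rewrite /GRing.comm /= -scalerAr -scalerAl mul1r mulr1.
Qed.

HB.instance Definition _ :=
  GRing.isMonoidMorphism.Build (free_alg K a n) A free_lift
    free_lift_is_monoid_morphism.

Lemma free_liftZ c x : free_lift (c *: x) = c *: free_lift x.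
Proof. by rewrite /free_lift mmapZ /= -scalerAl mul1r. Qed.

Lemma free_lift_t i j r : free_lift (free_t K i j r) = T i j r.
Proof.
case: r => [|r] /=; first by rewrite rmorph_nat T0.
by rewrite /free_lift mmapU /= scale1r mul1r /monom_lift fmU big_seq1.
Qed.

Lemma free_lift_ideal x : rel_ideal x -> free_lift x = 0.
Proof.
elim=> [|u v _ hu _ hv|b u c [i [j [k [l [r [s ->]]]]]]]; first exact: rmorph0.
  by rewrite rmorphD /= hu hv addr0.
rewrite !rmorphM /= (@rtt_morph K a n _ _ (@free_t K a n) free_lift free_liftZ).
have -> : (fun (i j : idx a n) r => free_lift (free_t K i j r)) = T.
  by do 3 apply/funext => ?; exact: free_lift_t.
by rewrite T_rtt subrr mulr0 mul0r.
Qed.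

Definition ey_lift (x : ext_yangian K a n) : A := free_lift (repr x).

Lemma ey_lift_pi x : ey_lift (ey_pi x) = free_lift x.
Proof.
apply/eqP; rewrite -subr_eq0 -rmorphB; apply/eqP/free_lift_ideal.
exact: ey_repr_pi.
Qed.

Lemma ey_lift_is_zmod_morphism : zmod_morphism ey_lift.
Proof.
move=> x y; rewrite -[x]ey_pi_surj -[y]ey_pi_surj -ey_piN -ey_piD.
by rewrite !ey_lift_pi rmorphB.
Qed.

Lemma ey_lift_is_monoid_morphism : monoid_morphism ey_lift.
Proof.
split; first by rewrite -[1]/(ey_pi 1) ey_lift_pi rmorph1.
move=> x y; rewrite -[x]ey_pi_surj -[y]ey_pi_surj.
by rewrite ey_mulE !ey_lift_pi rmorphM.
Qed.

Lemma ey_liftZ c x : ey_lift (c *: x) = c *: ey_lift x.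
Proof.
by rewrite -[x]ey_pi_surj ey_scaleE !ey_lift_pi free_liftZ.
Qed.

Lemma ey_lift_t i j r : ey_lift (ey_t K i j r) = T i j r.
Proof. by rewrite ey_lift_pi free_lift_t. Qed.

HB.instance Definition _ := GRing.isZmodMorphism.Build
  (ext_yangian K a n) A ey_lift ey_lift_is_zmod_morphism.
HB.instance Definition _ := GRing.isMonoidMorphism.Build
  (ext_yangian K a n) A ey_lift ey_lift_is_monoid_morphism.

Lemma ext_yangian_lift : exists2 f : {rmorphism ext_yangian K a n -> A},
  (forall c x, f (c *: x) = c *: f x) & forall i j r, f (ey_t K i j r) = T i j r.
Proof. by exists ey_lift; [exact: ey_liftZ|exact: ey_lift_t]. Qed.

End Lift.

(** * Words in the generators span the extended Yangian *)

Section Words.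
Context (K : fieldType) (a : lie_type) (n : nat).
Local Notation X := (ext_yangian K a n).
Local Notation free := (free_alg K a n).

Lemma malgU_mul (c d : K) (k l : {fmonom gen a n}) :
  << c *g k >> * << d *g l >> = << c * d *g mmul k l >> :> free.
Proof. exact: fgmulUU. Qed.

Lemma ey_pi_monom (c : K) (k : {fmonom gen a n}) :
  ey_pi (<< c *g k >> : free) = c *: tword (@ey_t K a n) k.
Proof.
have -> : << c *g k >> = c *: << k >> :> free.
  by rewrite -mul_malgC malgU_mul mulr1 mul1m.
rewrite -ey_scaleE; congr (_ *: _).
case: k; elim=> [|g w IH].
  rewrite /tword big_nil -[RHS](rmorph1 (@ey_pi K a n)); congr ey_pi.
  by congr << _ *g _ >>; apply/eqP; rewrite fmP fm1.
have -> : << FMonom (g :: w) >> = << fmu g >> * << FMonom w >> :> free.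
  rewrite malgU_mul mulr1; congr << _ *g _ >>; apply/eqP.
  by rewrite fmP fmM fmU.
have -> : tword (@ey_t K a n) (g :: w) =
    ey_t K g.1.1 g.1.2 g.2.+1 * tword (@ey_t K a n) w by exact: big_cons.
by rewrite -IH; case: g => [[i j] r]; rewrite [RHS]ey_mulE.
Qed.

Lemma ey_words (P : X -> Prop) : P 0 -> (forall x y, P x -> P y -> P (x + y)) ->
  (forall c w, P (c *: tword (@ey_t K a n) w)) -> forall x, P x.
Proof.
move=> P0 PD PW x; rewrite -[x]ey_pi_surj [repr x]monalgE raddf_sum.
by apply: big_ind => // k _; rewrite /= ey_pi_monom.
Qed.

End Words.

(** * Derivations of the associated graded algebra *)

Section Derivations.
Context (K : numFieldType) (a : lie_type) (n : nat) (X : algType K).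
Variable t : idx a n -> idx a n -> nat -> X.
Hypothesis t0 : forall i j, t i j 0 = (i == j)%:R.
Local Notation filt := (filt t).
Local Notation tword := (tword t).
Implicit Types (D : X -> X).

(* A derivation of the associated graded algebra lowering the degree by e, given
   by an operator on X. *)
Record graded_derivation (e : nat) D : Prop := GradedDerivation {
  gderivD : forall x y, D (x + y) = D x + D y;
  gderivZ : forall c x, D (c *: x) = c *: D x;
  gderiv_filt : forall d l x, filt d l x -> filt (d - e%:Z) (l - 1) (D x);
  gderivM : forall d l d' l' x y, filt d l x -> filt d' l' y ->
    filt (d + d' - e%:Z) (l + l' - 2) (D (x * y) - (D x * y + x * D y))
}.

Lemma gderiv_add e D1 D2 : graded_derivation e D1 -> graded_derivation e D2 ->
  graded_derivation e (fun x => D1 x + D2 x).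
Proof.
move=> [D1D D1Z D1f D1M] [D2D D2Z D2f D2M];
  split=> [x y|c x|d l x h|d l d' l' x y hx hy].
- by rewrite D1D D2D addrACA.
- by rewrite D1Z D2Z scalerDr.
- by apply: filtD; [exact: D1f|exact: D2f].
have -> : D1 (x * y) + D2 (x * y) - ((D1 x + D2 x) * y + x * (D1 y + D2 y)) =
    (D1 (x * y) - (D1 x * y + x * D1 y)) + (D2 (x * y) - (D2 x * y + x * D2 y)).
  by rewrite mulrDl mulrDr addrACA opprD addrACA.
by apply: filtD; [exact: D1M hx hy|exact: D2M hx hy].
Qed.

Lemma gderiv_scale e D b : graded_derivation e D ->
  graded_derivation e (fun x => b *: D x).
Proof.
move=> [DD DZ Df DM]; split=> [x y|c x|d l x h|d l d' l' x y hx hy].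
- by rewrite DD scalerDr.
- by rewrite DZ !scalerA mulrC.
- by apply: filtZ; exact: Df.
by rewrite -scalerAl -scalerAr -scalerDr -scalerBr; apply: filtZ; exact: DM hx hy.
Qed.

Lemma gderiv0 e : graded_derivation e (fun=> 0).
Proof.
split=> [x y|c x|d l x h|d l d' l' x y hx hy]; rewrite ?addr0 ?scaler0 //.
  exact: filt0.
by rewrite mul0r mulr0 addr0 subr0; exact: filt0.
Qed.

Lemma gderiv_sum e (I : Type) (r : seq I) (P : pred I) (D : I -> X -> X) :
  (forall i, graded_derivation e (D i)) ->
  graded_derivation e (fun x => \sum_(i <- r | P i) D i x).
Proof.
move=> h; elim: r => [|i r IH].
  have -> : (fun x => \sum_(i <- [::] | P i) D i x) = (fun=> 0).
    by apply/funext => x; rewrite big_nil.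
  exact: gderiv0.
have -> : (fun x => \sum_(j <- i :: r | P j) D j x) =
  (fun x => (if P i then D i x else 0) + \sum_(j <- r | P j) D j x).
  by apply/funext => x; rewrite big_cons; case: ifP => // _; rewrite add0r.
apply: gderiv_add IH; case: (P i); [exact: h|exact: gderiv0].
Qed.

Section MatrixCoefficient.
Variables (m w : nat) (L : idx a n -> idx a n -> nat -> matalg K^o m).
Variable Delta : {rmorphism X -> matalg X m}.
Hypothesis DeltaZ : forall c x, Delta (c *: x) = c *: Delta x.
Hypothesis Delta_t : forall i j r, Delta (t i j r) =
  tmul (fun i j r => matalg_const m (t i j r))
    (fun i j r => matalg_ext X (L i j r)) i j r.
Hypothesis L0 : forall i j, L i j 0 = (i == j)%:R.
Hypothesis L_weight : forall i j r x y k, (r < k * w)%N -> (L i j r.+1 x y)`_k = 0.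
Local Notation cst := (matalg_const m).
Local Notation ext := (matalg_ext X).

(* The matrix variable is given degree w. *)
Definition mfilt (d l : int) (M : matalg X m) : Prop :=
  forall x y k, filt (d - (k * w)%N%:Z) l (M x y)`_k.

Lemma mfiltD d l M N : mfilt d l M -> mfilt d l N -> mfilt d l (M + N).
Proof. by move=> hM hN x y k; rewrite mxE coefD; apply: filtD. Qed.

Lemma mfiltZ d l c M : mfilt d l M -> mfilt d l (c *: M).
Proof.
move=> hM x y k; rewrite matalg_scaleE coefCM -scalerAl mul1r.
exact/filtZ/hM.
Qed.

Lemma mfilt0 d l : mfilt d l 0.
Proof. by move=> x y k; rewrite mxE coef0; exact: filt0. Qed.

Lemma mfilt_le d l d' l' M : below d l d' l' -> mfilt d l M -> mfilt d' l' M.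
Proof.
by move=> h hM x y k; apply: filt_le (hM x y k); move: h; rewrite /below; lia.
Qed.

Lemma mfiltM d l d' l' M N :
  mfilt d l M -> mfilt d' l' N -> mfilt (d + d') (l + l') (M * N).
Proof.
move=> hM hN x y k; rewrite mxE coef_sum; apply: filt_sum => p _.
rewrite coefM; apply: filt_sum => q _; have hq := ltn_ord q.
apply: filtMZ (hM x p q) (hN p y (k - q)%N).
have e : (k * w = q * w + (k - q) * w)%N by rewrite -mulnDl subnKC.
by rewrite e /below; move: (q * w)%N ((k - q) * w)%N => *; lia.
Qed.

Lemma mfiltMZ d l d' l' d2 l2 M N : below (d + d') (l + l') d2 l2 ->
  mfilt d l M -> mfilt d' l' N -> mfilt d2 l2 (M * N).
Proof. by move=> h hM hN; exact: mfilt_le h (mfiltM hM hN). Qed.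

Lemma mfilt_const d l x : filt d l x -> mfilt d l (cst x).
Proof.
move=> hx i j k; rewrite mxE; case: (i == j); rewrite ?mulr0n ?coef0;
  last exact: filt0.
rewrite mulr1n coefC; case: eqP => [->|_]; last exact: filt0.
by rewrite mul0n subr0.
Qed.

Lemma mfilt_L i j r : mfilt r%:Z 0 (ext (L i j r.+1)).
Proof.
move=> x y k; rewrite coef_matalg_ext.
have [h|h] := leqP (k * w) r; last by rewrite L_weight // scale0r; exact: filt0.
by apply/filtZ/filt1 => //; move: h; move: (k * w)%N => *; lia.
Qed.

(** The product of the two series is t 1 + 1 L plus mixed terms t^(q+1) L^(r-q), which have degree q
    + (r - q - 1) = r - 1. *)
Lemma mfilt_Delta_t i j r :
  mfilt (r%:Z - 1) 1 (Delta (t i j r.+1) - cst (t i j r.+1) - ext (L i j r.+1)).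
Proof.
rewrite Delta_t /tmul.
have -> : \sum_p smul (fun r => cst (t i p r)) (fun r => ext (L p j r)) r.+1 =
  \sum_p \sum_(q < r) cst (t i p q.+1) * ext (L p j (r - q)%N) +
  ext (L i j r.+1) + cst (t i j r.+1).
  rewrite /smul; under eq_bigr do rewrite big_ord_recl big_ord_recr /= subnn subn0.
  rewrite !big_split /= addrA [X in X + _ = _]addrC; congr (_ + _ + _).
  - rewrite (bigD1 i) //= t0 eqxx rmorph1 mul1r big1 ?addr0 // => p.
    by rewrite eq_sym t0 => /negbTE ->; rewrite rmorph0 mul0r.
  - rewrite (bigD1 j) //= L0 eqxx rmorph1 mulr1 big1 ?addr0 // => p.
    by rewrite L0 => /negbTE ->; rewrite rmorph0 mulr0.
rewrite !addrK.
apply: (big_ind (mfilt (r%:Z - 1) 1)) => [||p _]; [exact: mfilt0|exact: mfiltD|].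
apply: (big_ind (mfilt (r%:Z - 1) 1)) => [||q _]; [exact: mfilt0|exact: mfiltD|].
have hq := ltn_ord q; rewrite -(subnSK hq).
by apply: mfiltMZ (mfilt_const (filt_t t i p q)) (mfilt_L _ _ _);
  rewrite /below; lia.
Qed.

Lemma mfilt_Delta_gen i j r : mfilt r%:Z 0 (Delta (t i j r.+1) - cst (t i j r.+1)).
Proof.
rewrite -[_ - _](subrK (ext (L i j r.+1))); apply: mfiltD (mfilt_L _ _ _).
by apply: mfilt_le (mfilt_Delta_t i j r); rewrite /below; lia.
Qed.

Lemma mfilt_Delta d l x : filt d l x -> mfilt d (l - 1) (Delta x - cst x).
Proof.
elim=> [|u v _ hu _ hv|b v hv].
- by rewrite !rmorph0 subrr; exact: mfilt0.
- by rewrite !rmorphD opprD addrACA; exact: mfiltD.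
rewrite DeltaZ matalg_constZ -scalerBr; apply: mfiltZ.
suff h : mfilt (wdeg v)%:Z ((size v)%:Z - 1) (Delta (tword v) - cst (tword v)).
  by apply: mfilt_le h; move: hv; rewrite /below; lia.
elim: v {hv} => [|[[i j] r] v IH].
  by rewrite [tword _]big_nil !rmorph1 subrr; exact: mfilt0.
have -> : tword ((i, j, r) :: v) = t i j r.+1 * tword v by exact: big_cons.
have -> : wdeg ((i, j, r) :: v) = (r + wdeg v)%N by exact: big_cons.
have hv : filt (wdeg v)%:Z (size v)%:Z (tword v).
  by rewrite -[tword v]scale1r; apply: filtW; exact: below_refl.
rewrite !rmorphM /= mulr_subE.
have hD : mfilt (wdeg v)%:Z (size v)%:Z (Delta (tword v)).
  rewrite -(subrK (cst (tword v)) (Delta _)); apply: mfiltD (mfilt_const hv).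
  by apply: mfilt_le IH; rewrite /below; lia.
apply: mfiltD.
  apply: mfiltMZ (mfilt_Delta_gen i j r) hD.
  by rewrite /below /=; move: (wdeg v) (size v) => *; lia.
apply: mfiltMZ (mfilt_const (filt_t t i j r)) IH.
by rewrite /below /=; move: (wdeg v) (size v) => *; lia.
Qed.

Definition matrix_coef (x y : 'I_m.+1) (k : nat) (u : X) : X :=
  ((Delta u - cst u) x y)`_k.

(** For delta = Delta - id the Leibniz error delta(uv) - delta(u) v - u delta(v) is exactly delta(u)
    delta(v), and each factor is shorter by one. Taking the coefficient of x^k lowers the degree by
    k w. *)
Lemma matrix_coef_gderiv x y k : graded_derivation (k * w) (matrix_coef x y k).
Proof.
split=> [u v|c u|d l u h|d l d' l' u v hu hv]; rewrite /matrix_coef.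
- by rewrite !rmorphD opprD addrACA mxE coefD.
- by rewrite DeltaZ matalg_constZ -scalerBr matalg_scaleE coefCM -scalerAl mul1r.
- exact: mfilt_Delta.
have -> : ((Delta (u * v) - cst (u * v)) x y)`_k -
   (((Delta u - cst u) x y)`_k * v + u * ((Delta v - cst v) x y)`_k) =
   (((Delta u - cst u) * (Delta v - cst v)) x y)`_k.
  rewrite -coefMC -coefCM -matalg_constM -matalg_Mconst -coefD.
  have eD (M N : matalg X m) : M x y + N x y = (M + N) x y by rewrite mxE.
  have eN (M N : matalg X m) : (M x y)`_k - (N x y)`_k = ((M - N) x y)`_k.
    by rewrite !mxE coefB.
  rewrite eD eN !rmorphM; congr (_`_k); congr (_ x y : {poly X}).
  by rewrite mulr_subE opprD addrACA subrr addr0 -mulrBr.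
have -> : l + l' - 2 = l - 1 + (l' - 1) by lia.
exact: (mfiltM (mfilt_Delta hu) (mfilt_Delta hv)).
Qed.

Lemma matrix_coef_t x y k i j r : filt (r%:Z - (k * w)%N%:Z) (- 1)
  (matrix_coef x y k (t i j r.+1) - ((L i j r.+1 x y)`_k *: 1)).
Proof.
rewrite -coef_matalg_ext /matrix_coef -coefB.
have -> : (Delta (t i j r.+1) - cst (t i j r.+1)) x y - ext (L i j r.+1) x y =
  (Delta (t i j r.+1) - cst (t i j r.+1) - ext (L i j r.+1)) x y by rewrite !mxE.
by apply: filt_le (mfilt_Delta_t i j r x y k); rewrite /below; lia.
Qed.

End MatrixCoefficient.
End Derivations.

(** * Ordered monomials are independent *)

Section Removal.
Context (T : eqType).
Implicit Types (h g : T) (w v : seq T).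

(** All words obtained from [w] by deleting one occurrence of [h]: the terms of the partial
    derivative of a monomial by [h]. *)
Fixpoint removals h w : seq (seq T) :=
  if w is g :: w' then
    (if g == h then [:: w'] else [::]) ++ [seq g :: v | v <- removals h w']
  else [::].

Lemma removals_perm h w v : v \in removals h w -> perm_eq (h :: v) w.
Proof.
elim: w v => [//|g w IH] v; rewrite mem_cat => /orP[].
  by case: eqP => [->|] //; rewrite inE => /eqP ->.
move=> /mapP[u /IH hu ->].
by rewrite (perm_catCA [:: h] [:: g] u) /= perm_cons.
Qed.

Lemma removals_nil h w : (removals h w == [::]) = (h \notin w).
Proof.
elim: w => [//|g w IH]; rewrite inE negb_or -IH /= [h == g]eq_sym.
by case: (g == h) => //=; case: (removals h w).
Qed.

End Removal.

Lemma seq_argmax (I : eqType) (f : I -> nat) (s : seq I) : s != [::] ->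
  exists2 i, i \in s & forall j, j \in s -> (f j <= f i)%N.
Proof.
elim: s => [//|i s IH] _; have [->|/IH[j js hj]] := eqVneq s [::].
  by exists i => [|j]; rewrite inE // => /eqP ->.
have [hij|/ltnW hij] := leqP (f i) (f j).
  by exists j => [|k]; rewrite inE ?js ?orbT // => /orP[/eqP ->|/hj].
exists i => [|k]; rewrite inE ?eqxx // => /orP[/eqP -> //|/hj hk].
exact: leq_trans hk hij.
Qed.

Section Independence.
Context (K : numFieldType) (a : lie_type) (n : nat) (X : algType K).
Variable t : idx a n -> idx a n -> nat -> X.
Hypothesis t0 : forall i j, t i j 0 = (i == j)%:R.
Variable z : nat -> X.
Hypothesis zP : is_zseries t z.
Variable i0 : idx a n.
Local Notation filt := (filt t).
Local Notation pbw := (pbw_index a n).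
Local Notation pword := (pword t z).
Local Notation pbw_gen := (pbw_gen t z).
Variable D : pbw -> X -> X.
Hypothesis D_gderiv : forall h, graded_derivation t (pbw_deg h) (D h).
Hypothesis D_gen : forall h g, filt ((pbw_deg g)%:Z - (pbw_deg h)%:Z) (- 1)
  (D h (pbw_gen g) - (g == h)%:R).

Fixpoint iterD (h : seq pbw) (x : X) : X :=
  if h is g :: h' then iterD h' (D g x) else x.

Lemma iterDD h x y : iterD h (x + y) = iterD h x + iterD h y.
Proof. by elim: h x y => //= g h IH x y; rewrite (gderivD (D_gderiv g)) IH. Qed.

Lemma iterDZ h c x : iterD h (c *: x) = c *: iterD h x.
Proof. by elim: h x => //= g h IH x; rewrite (gderivZ (D_gderiv g)) IH. Qed.

Lemma iterD_sum h (I : Type) (r : seq I) (F : I -> X) :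
  iterD h (\sum_(i <- r) F i) = \sum_(i <- r) iterD h (F i).
Proof.
elim: r => [|i r IH]; last by rewrite !big_cons iterDD IH.
by rewrite !big_nil -[X in iterD _ X](scale0r 0) iterDZ scale0r.
Qed.

Lemma filt_iterD h d l x : filt d l x ->
  filt (d - (pdeg h)%:Z) (l - (size h)%:Z) (iterD h x).
Proof.
elim: h d l x => [|g h IH] d l x hx.
  by apply: filt_le hx; rewrite /pdeg big_nil /below /=; lia.
apply: filt_le (IH _ _ _ (gderiv_filt (D_gderiv g) hx)).
rewrite [pdeg (g :: h)]big_cons -/(pdeg h) /below /=.
by move: (pdeg h) (pbw_deg g) (size h) => *; lia.
Qed.

Lemma filt_empty d l x : (d < 0) || (d <= 0) && (l < 0) -> filt d l x -> x = 0.
Proof.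
move=> hd; elim=> [//|u v _ -> _ ->|c w]; first by rewrite addr0.
by move: hd; rewrite /below; lia.
Qed.

Lemma iterD_vanish h d l x : filt d l x ->
  (d < (pdeg h)%:Z) || (d <= (pdeg h)%:Z) && (l < (size h)%:Z) -> iterD h x = 0.
Proof.
move=> hx hd; apply: filt_empty (filt_iterD h hx).
by move: hd; move: (pdeg h) (size h) => *; lia.
Qed.

(** Modulo lower terms [D h] acts on monomials as the partial derivative by [h]. *)
Lemma D_pword h w :
  filt ((pdeg w)%:Z - (pbw_deg h)%:Z) ((size w)%:Z - 2)
    (D h (pword w) - \sum_(v <- removals h w) pword v).
Proof.
have gw g v : pword (g :: v) = pbw_gen g * pword v by exact: big_cons.
elim: w => [|g w IH].
  have h1 : filt 0 0 (1 : X) by exact: filt1.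
  (* The value at 1 is controlled only through the Leibniz error of 1 * 1, which puts it in length
     -2. *)
  have h2 : D h 1 = - (D h (1 * 1) - (D h 1 * 1 + 1 * D h 1)).
    by rewrite !mulr1 mul1r opprB addrK.
  rewrite big_nil subr0 [pword _]big_nil [pdeg _]big_nil h2.
  apply: filtN; apply: filt_le (gderivM (D_gderiv h) h1 h1).
  by rewrite /below; move: (pbw_deg h) => *; lia.
have -> : \sum_(v <- removals h (g :: w)) pword v =
    (g == h)%:R * pword w + pbw_gen g * \sum_(v <- removals h w) pword v.
  rewrite big_cat big_map mulr_sumr; congr (_ + _).
    by case: (g == h); rewrite ?big_seq1 ?big_nil ?mul1r ?mul0r.
  by apply: eq_bigr => v _; rewrite gw.
have hg := filt_pbw_gen t0 zP i0 g; have hw := filt_pword t0 zP i0 w.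
rewrite gw; set S := \sum_(v <- _) _ in IH *.
have -> : D h (pbw_gen g * pword w) - ((g == h)%:R * pword w + pbw_gen g * S) =
  (D h (pbw_gen g * pword w) - (D h (pbw_gen g) * pword w +
    pbw_gen g * D h (pword w)))
  + ((D h (pbw_gen g) - (g == h)%:R) * pword w + pbw_gen g * (D h (pword w) - S)).
  by rewrite mulrBl mulrBr [X in _ = _ + X]addrACA -opprD addrA subrK.
rewrite [pdeg (g :: w)]big_cons -/(pdeg w) /=.
apply: filtD; last apply: filtD.
- apply: filt_le (gderivM (D_gderiv h) hg hw).
  by rewrite /below; move: (pdeg w) (pbw_deg g) (pbw_deg h) (size w) => *; lia.
- apply: filtMZ (D_gen h g) hw.
  by rewrite /below; move: (pdeg w) (pbw_deg g) (pbw_deg h) (size w) => *; lia.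
apply: filtMZ hg IH.
by rewrite /below; move: (pdeg w) (pbw_deg g) (pbw_deg h) (size w) => *; lia.
Qed.

(** With equal degrees and lengths all letters are used up, and every error term falls into a zero
    part of the filtration, so the value is an exact scalar. It counts the ways of deleting the
    letters of [h] one after the other from [w]. *)
Lemma iterD_pword h w : pdeg w = pdeg h -> size w = size h ->
  exists2 c : nat, iterD h (pword w) = c%:R & (0 < c)%N = perm_eq h w.
Proof.
elim: h w => [|g h IH] w ew sw.
  by move/size0nil: sw => ->; exists 1; rewrite // [iterD _ _]big_nil.
have eg : pdeg (g :: h) = (pbw_deg g + pdeg h)%N by exact: big_cons.
have hv v : v \in removals g w -> pdeg v = pdeg h /\ size v = size h.
  move=> /removals_perm hv; have := perm_size hv; rewrite sw => -[->]; split=> //.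
  have: pdeg (g :: v) = pdeg (g :: h) by rewrite -ew /pdeg; apply: perm_big.
  by rewrite eg [pdeg (g :: v)]big_cons -/(pdeg v) => /addnI.
have hD : iterD h (D g (pword w)) = \sum_(v <- removals g w) iterD h (pword v).
  rewrite -iterD_sum -[D g _](subrK (\sum_(v <- removals g w) pword v)) iterDD.
  rewrite (iterD_vanish (D_pword g w)) ?add0r // ew eg sw /=.
  by move: (pdeg h) (pbw_deg g) (size h) => *; lia.
have perm_rem v : v \in removals g w -> perm_eq (g :: h) w = perm_eq h v.
  by move=> /removals_perm hgv; rewrite -(perm_cons g h v) (permPr hgv).
have : exists2 c : nat, \sum_(v <- removals g w) iterD h (pword v) = c%:R &
    (0 < c)%N = has (perm_eq h) (removals g w).
  elim: (removals g w) hv => [|v r IHr] hv; first by exists 0%N; rewrite ?big_nil.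
  have [pv sv] := hv v (mem_head _ _); have [c1 e1 f1] := IH v pv sv.
  have [|c2 e2 f2] := IHr; first by move=> u hu; apply: hv; rewrite inE hu orbT.
  by exists (c1 + c2)%N; rewrite ?big_cons ?e1 ?e2 ?natrD //= addn_gt0 f1 f2.
move=> [c ec fc]; exists c; first by rewrite /= hD.
rewrite fc; apply/hasP/idP => [[v hv1 hv2]|hp]; first by rewrite (perm_rem v).
have : g \in w by rewrite -(perm_mem hp) mem_head.
rewrite -[g \in w]negbK -removals_nil.
case e : (removals g w) => [//|v r] _;
  have hvr : v \in removals g w by rewrite e mem_head.
by exists v; rewrite -?e // -(perm_rem v).
Qed.

Variable le : rel pbw.
Hypothesis le_order : total_order le.

(** Among the words with nonzero coefficient one of maximal degree, and then of maximal length, is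
    chosen. Its iterated operator kills all shorter words of that degree and all words of smaller
    degree; among the remaining ones it detects only permutations of the chosen word, and sorted
    words that are permutations of each other coincide. *)
Lemma pword_free (s : seq {w : seq pbw | sorted le w})
  (c : {w : seq pbw | sorted le w} -> K) :
  uniq s -> \sum_(i <- s) c i *: pword (val i) = 0 -> forall i, i \in s -> c i = 0.
Proof.
move=> us es i si; apply/eqP; apply: contraT => ci.
pose s1 := [seq j <- s | c j != 0].
have s1n : s1 != [::] by rewrite -has_filter; apply/hasP; exists i.
have [j1 sj1 hj1] := seq_argmax (fun j => pdeg (val j)) s1n.
pose s2 := [seq j <- s1 | pdeg (val j) == pdeg (val j1)].
have s2n : s2 != [::] by rewrite -has_filter; apply/hasP; exists j1; rewrite //=.
have [j sj hj] := seq_argmax (fun j => size (val j)) s2n.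
move: sj; rewrite mem_filter => /andP[/eqP ej]; rewrite mem_filter => /andP[cj sj].
have := congr1 (iterD (val j)) es.
have iter0 : iterD (val j) 0 = 0 by rewrite -(scale0r (0 : X)) iterDZ !scale0r.
rewrite iter0 iterD_sum (bigD1_seq j) //= big1_seq ?addr0 => [|k /andP[kj sk]].
  have [b eb] := @iterD_pword (val j) (val j) erefl erefl.
  rewrite perm_refl iterDZ eb => b0 /eqP; rewrite -scaler_nat.
  rewrite !scaler_eq0 (negbTE cj) pnatr_eq0 oner_eq0 orbF /=.
  by rewrite eqn0Ngt b0.
rewrite iterDZ; have [->|ck] := eqVneq (c k) 0; first by rewrite scale0r.
have sk1 : k \in s1 by rewrite mem_filter ck.
have hk := filt_pword t0 zP i0 (val k).
have := hj1 k sk1; rewrite leq_eqVlt => /orP[/eqP ek|hlt]; last first.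
  by rewrite (iterD_vanish hk) ?scaler0 // ej ltz_nat hlt.
have sk2 : k \in s2 by rewrite mem_filter ek eqxx.
have := hj k sk2; rewrite leq_eqVlt => /orP[/eqP fk|hlt]; last first.
  rewrite (iterD_vanish hk) ?scaler0 //; apply/orP; right.
  by rewrite ej ek lexx ltz_nat hlt.
have [|b -> hb] := iterD_pword _ fk; first by rewrite ek ej.
have : ~~ perm_eq (val j) (val k).
  apply: contra kj => hp; apply/eqP/val_inj; have [_ le_asym le_tr _] := le_order.
  by apply: (sorted_eq le_tr le_asym); rewrite ?(valP j) ?(valP k) // perm_sym.
by rewrite -hb -eqn0Ngt => /eqP ->; rewrite scaler0.
Qed.

End Independence.

Lemma rtt_map (K : fieldType) (a : lie_type) (n : nat) (A B : algType K)
    (t : idx a n -> idx a n -> nat -> A) (f : {rmorphism A -> B}) :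
  (forall c x, f (c *: x) = c *: f x) ->
  (forall i j k l r s, rtt_lhs t i j k l r s = rtt_rhs t i j k l r s) ->
  forall i j k l r s, rtt_lhs (fun i j r => f (t i j r)) i j k l r s =
                      rtt_rhs (fun i j r => f (t i j r)) i j k l r s.
Proof.
move=> fZ h i j k l r s; apply/eqP; rewrite -subr_eq0 -(rtt_morph _ fZ).
by rewrite h subrr rmorph0.
Qed.

Lemma tmul0 (K : fieldType) (a : lie_type) (n : nat) (A : algType K)
    (t1 t2 : idx a n -> idx a n -> nat -> A) i j :
  (forall i j, t1 i j 0 = (i == j)%:R) -> (forall i j, t2 i j 0 = (i == j)%:R) ->
  tmul t1 t2 i j 0 = (i == j)%:R.
Proof.
move=> h1 h2; rewrite /tmul (bigD1 i) //= big1 ?addr0 => [|p].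
  by rewrite /smul big_ord1 h1 h2 eqxx mul1r.
by rewrite /smul big_ord1 h1 eq_sym => /negbTE ->; rewrite mul0r.
Qed.

Lemma enum_bij (T : finType) (x0 : T) : exists m (f : 'I_m.+1 -> T), bijective f.
Proof.
exists #|T|.-1; have e : #|T|.-1.+1 = #|T| by rewrite prednK //;
  apply/card_gt0P; exists x0.
exists (fun i => enum_val (cast_ord e i));
  exists (fun x => cast_ord (esym e) (enum_rank x)).
  by move=> i; rewrite enum_valK cast_ordK.
by move=> x; rewrite cast_ordKV enum_rankK.
Qed.

(** * Operators dual to the chosen generators *)

Section DerivationFamily.
Context (K : numFieldType) (a : lie_type) (n : nat) (X : algType K).
Local Notation idx := (idx a n).
Variable t : idx -> idx -> nat -> X.
Hypothesis t0 : forall i j, t i j 0 = (i == j)%:R.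
Hypothesis rtt : forall i j k l r s, rtt_lhs t i j k l r s = rtt_rhs t i j k l r s.
Hypothesis t_lift : forall m (T : idx -> idx -> nat -> matalg X m),
  (forall i j, T i j 0 = (i == j)%:R) ->
  (forall i j k l r s, rtt_lhs T i j k l r s = rtt_rhs T i j k l r s) ->
  exists2 f : {rmorphism X -> matalg X m},
    (forall c x, f (c *: x) = c *: f x) & forall i j r, f (t i j r) = T i j r.
Variable z : nat -> X.
Hypothesis zP : is_zseries t z.
Variable i0 : idx.
Local Notation filt := (filt t).
Local Notation pbw := (pbw_index a n).
Local Notation pbw_gen := (pbw_gen t z).
Local Notation graded_derivation := (graded_derivation t).

Definition symbol_on_t (e : nat) (D : X -> X) (c : idx -> idx -> nat -> K) : Prop :=
  forall i j r, filt (r%:Z - e%:Z) (- 1) (D (t i j r.+1) - c i j r *: 1).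

(** Delta is the coproduct followed by the representation [L] on the second tensor factor. The
    universal property yields this composite directly, from the product of the two commuting
    solutions. *)
Lemma gderiv_of_rep m w (L : idx -> idx -> nat -> matalg K^o m) x y k :
  (forall i j, L i j 0 = (i == j)%:R) ->
  (forall i j k l r s, rtt_lhs L i j k l r s = rtt_rhs L i j k l r s) ->
  (forall i j r x y k, (r < k * w)%N -> (L i j r.+1 x y)`_k = 0) ->
  exists2 D, graded_derivation (k * w) D &
    symbol_on_t (k * w) D (fun i j r => (L i j r.+1 x y)`_k).
Proof.
move=> L0 L_rtt Lw.
have C_rtt := rtt_map (f := matalg_const m) (@matalg_constZ K X m) rtt.
have E_rtt := rtt_map (f := matalg_ext X (m := m)) (@matalg_extZ K X m) L_rtt.
have hC i j k' l r s : matalg_const m (t i j r) * matalg_ext X (L k' l s) =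
    matalg_ext X (L k' l s) * matalg_const m (t i j r) by exact: matalg_const_ext.
have [f fZ ft] := t_lift (fun i j => tmul0 i j
  (fun i j => etrans (congr1 (matalg_const m) (t0 i j)) (rmorph_nat _ _))
  (fun i j => etrans (congr1 (matalg_ext X (m := m)) (L0 i j)) (rmorph_nat _ _)))
  (rtt_tmul C_rtt E_rtt hC).
exists (matrix_coef f x y k).
  exact: (matrix_coef_gderiv t0 fZ ft L0 Lw).
by move=> i j r; exact: (matrix_coef_t t0 ft L0 Lw).
Qed.

(** For r > e every scalar already lies below degree r - e and length -1, so the symbol may be
    changed freely there. *)
Lemma symbol_truncate e D (c c' : idx -> idx -> nat -> K) :
  (forall i j r, (r <= e)%N -> c i j r = c' i j r) ->
  symbol_on_t e D c -> symbol_on_t e D c'.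
Proof.
move=> h hc i j r; have [/h <- //|hr] := leqP r e.
rewrite -[D _](subrK (c i j r *: 1)) -addrA -scalerBl; apply: filtD => //.
apply/filtZ; apply: (@filt_le _ _ _ _ _ 0 0); last exact: filt1.
by rewrite /below; lia.
Qed.

Definition vec_symbol (i j i' j' : idx) : K :=
  th K i' j' *+ ((i' == opp_idx j) && (j' == opp_idx i)) -
  ((j' == j) && (i' == i))%:R.

Lemma vector_gderiv i j e : exists2 D, graded_derivation e D &
  symbol_on_t e D (fun i' j' r => (r == e)%:R * vec_symbol i j i' j').
Proof.
have [m [un un_bij]] := enum_bij i0.
have [inv unK invK] := un_bij.
(* The pole at x carries the matrix unit E_ji in t_ij(u), hence row j and column i. Here x has
   weight 1. *)
have := @gderiv_of_rep m 1 (@vec_rep K a n m un) (inv j) (inv i) e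
  (@vec_rep0 K a n m un un_bij) (@vec_rep_rtt K a n m un un_bij) _.
rewrite muln1 => /(_ _)[|D hD hc].
  by move=> *; apply: coef_vec_rep_gt; rewrite -[X in (_ < X)%N]muln1.
exists D => //; apply: symbol_truncate hc => i' j' r; rewrite leq_eqVlt.
case/orP => [/eqP ->|hr].
  by rewrite coef_vec_rep_top !invK eqxx mul1r.
by rewrite coef_vec_rep_gt // ltn_eqF // mul0r.
Qed.

(* The representation t_ij(u) = delta_ij (1 + x u^-(e + 1)), x a variable. *)
Lemma scalar_gderiv e : exists2 D, graded_derivation e D &
  symbol_on_t e D (fun i j r => ((r == e) && (i == j))%:R).
Proof.
have [m [un un_bij]] := enum_bij i0.
pose f r : matalg K^o m :=
  if r is r'.+1 then (if r' == e then ('X%:M : 'M_m.+1) else 0) else 1.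
have fC r s : f r * f s = f s * f r.
  case: r s => [|r] [|s]; rewrite ?mul1r ?mulr1 //=.
  by case: ifP; case: ifP; rewrite ?mul0r ?mulr0.
have fk i j r x y k : (scal_rep f i j r.+1 x y : {poly K^o})`_k =
    ((i == j) && (r == e) && (x == y) && (k == 1))%:R.
  rewrite /scal_rep /=; case: (i == j) => /=; last by rewrite mul0r mxE coef0.
  rewrite mul1r; case: (r == e) => /=; last by rewrite mxE coef0.
  rewrite mxE; case: (x == y) => /=; last by rewrite mulr0n coef0.
  by rewrite mulr1n coefX.
(* Here x has weight e, so its first power lowers the degree by e. *)
have := @gderiv_of_rep m e (scal_rep f) ord0 ord0 1 _ (scal_rep_rtt fC) _.
rewrite mul1n => /(_ _ _)[||D hD hc].
- by move=> i j; rewrite /scal_rep mulr1.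
- move=> i j r x y k h; rewrite fk; case: (k =P 1) h => [->|_];
  last by rewrite andbF.
  by rewrite mul1n => /ltn_eqF ->; rewrite andbF.
exists D => //; apply: symbol_truncate hc => i j r _.
by rewrite fk eqxx !andbT andbC.
Qed.

Lemma symbol_on_z e D c : graded_derivation e D -> symbol_on_t e D c ->
  forall r, filt (r%:Z - e%:Z) (- 1)
    (D (z r.+1) - (c i0 i0 r + c (opp_idx i0) (opp_idx i0) r) *: 1).
Proof.
move=> hD hc r; have hz := filt_z t0 zP i0 i0 r.
rewrite eqxx scale1r th_diag scale1r in hz; set u := t _ _ _ in hz;
  set v := t _ _ _ in hz.
have eDz : D (z r.+1) = D (z r.+1 - (u + v)) + (D u + D v).
  by rewrite -!(gderivD hD) subrK.
have -> : D (z r.+1) - (c i0 i0 r + c (opp_idx i0) (opp_idx i0) r) *: 1 =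
    D (z r.+1 - (u + v)) + ((D u - c i0 i0 r *: 1) +
    (D v - c (opp_idx i0) (opp_idx i0) r *: 1)).
  by rewrite eDz scalerDl -addrA; congr (_ + _); rewrite opprD addrACA.
apply: filtD; last by apply: filtD; exact: hc.
by apply: filt_le (gderiv_filt hD hz); rewrite /below; lia.
Qed.

(** The second term of the symbol lives at (-j, -i), which satisfies the condition together with (i,
    j) only if i + j = 0, where the two pairs coincide. *)
Lemma vec_symbol_pbw i j i' j' : pbw_cond (i, j) -> pbw_cond (i', j') ->
  vec_symbol i j i' j' = ((i', j') == (i, j))%:R * vec_symbol i j i j.
Proof.
move=> hij hij'; case: eqP => [[-> ->]|hne]; first by rewrite mul1r.
rewrite mul0r /vec_symbol.
have -> : (j' == j) && (i' == i) = false.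
  by apply/negP => /andP[/eqP ej /eqP ei]; apply: hne; rewrite ej ei.
have -> : (i' == opp_idx j) && (j' == opp_idx i) = false; last by rewrite subr0.
apply/negP => /andP[/eqP ei /eqP ej]; apply: hne.
have eij : val i + val j = 0.
  move: hij hij'; rewrite /pbw_cond ei ej /=.
  by move: (val i) (val j) => p q; case: (a) => /=; lia.
rewrite ei ej; congr (_, _); apply: val_inj; apply/eqP; rewrite /= eq_sym -addr_eq0.
  by rewrite eij.
by rewrite addrC eij.
Qed.

(** The value is -1, except for i + j = 0 in the symplectic case: there both terms contribute and
    give theta_i,-i - 1 = -2. *)
Lemma vec_symbol_neq0 i j : pbw_cond (i, j) -> vec_symbol i j i j != 0.
Proof.
rewrite /vec_symbol !eqxx => hij; case: andP => [[/eqP ei _]|_]; last first.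
  by rewrite mulr0n sub0r oppr_eq0 oner_eq0.
have -> : th K i j = - 1.
  have := valP j; rewrite mem_indices => /andP[_].
  move: hij; rewrite /th /theta /pbw_cond ei /=.
  move: (val j) => q; case: (a) => /=; rewrite ?addNr ?ltxx // => _ hq.
  by rewrite sgzN mulNr mulz_sg hq.
by rewrite mulr1n -opprD oppr_eq0 (pnatr_eq0 K 2).
Qed.

(** The two terms of the symbol are exchanged by k -> -k, so the vector operators do not see the
    leading part of z. *)
Lemma vec_symbol_z i j k :
  vec_symbol i j k k + vec_symbol i j (opp_idx k) (opp_idx k) = 0.
Proof.
by rewrite /vec_symbol !th_diag !eq_opp_idx !opp_idxK addrA subrK subrr.
Qed.

Lemma gen_gderiv (h : pbw) : exists2 D, graded_derivation (pbw_deg h) D &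
  forall g, filt ((pbw_deg g)%:Z - (pbw_deg h)%:Z) (- 1)
    (D (pbw_gen g) - (g == h)%:R).
Proof.
have eK (b : bool) : b%:R = (b%:R : K) *: (1 : X) by rewrite scaler_nat.
have vec (p : {p : idx * idx | pbw_cond p}) e : exists D, graded_derivation e D /\
    forall g, filt ((pbw_deg g)%:Z - e%:Z) (- 1)
      (D (pbw_gen g) - (g == inl (p, e))%:R).
  case: p => [[i j] hij]; set p := exist _ _ _.
  have [D hD hc] := vector_gderiv i j e; have g0 := vec_symbol_neq0 hij.
  exists (fun x => (vec_symbol i j i j)^-1 *: D x); split;
    first exact: gderiv_scale.
  case=> [[[[i' j'] hij'] r]|r] /=.
    have := hc i' j' r; rewrite (vec_symbol_pbw hij hij') =>
      /(filtZ (vec_symbol i j i j)^-1).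
    rewrite scalerBr scalerA eK.
    have -> (b1 b2 : bool) : (vec_symbol i j i j)^-1 *
        (b1%:R * (b2%:R * vec_symbol i j i j)) = (b1 && b2)%:R.
      by rewrite -mulnb natrM; field.
    suff -> : (r == e) && ((i', j') == (i, j)) =
      (inl (exist _ (i', j') hij', r) == inl (p, e) :> pbw) by [].
    rewrite andbC; apply/andP/eqP => [[/eqP h1 /eqP ->]|[h1 h2 ->]].
      by congr inl; congr pair; apply: val_inj.
    by rewrite h1 h2 !eqxx.
  have := symbol_on_z hD hc r; rewrite -mulrDr vec_symbol_z mulr0 scale0r subr0.
  by move/(filtZ (vec_symbol i j i j)^-1); rewrite subr0.
case: h => [[p r]|e]; first by have [D [hD hc]] := vec p r; exists D.
have [E hE] := choice (fun p => vec p e); have [D hD hc] := scalar_gderiv e.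
(* On the chosen t_ij^(e+1) the scalar operator [D] takes the values delta_ij, which [S] reproduces;
   [S] vanishes on z_(e+1), where [D] takes the value 2. *)
pose S x := \sum_(p | (val p).1 == (val p).2) E p x.
have hS : graded_derivation e S by apply: gderiv_sum => p; exact: (hE p).1.
exists (fun x => 2^-1 *: (D x + (-1) *: S x)).
  by apply/gderiv_scale/gderiv_add/gderiv_scale.
move=> g; have -> : 2^-1 *: (D (pbw_gen g) + (-1) *: S (pbw_gen g)) -
  (g == inr e)%:R =
    2^-1 *: (D (pbw_gen g) - S (pbw_gen g) - ((g == inr e)%:R * 2) *: 1).
  rewrite scalerBr scaleN1r scalerA mulrCA mulVf ?pnatr_eq0 // mulr1 -eK //.
apply: filtZ; have hSg (b : K) : b *: 1 = \sum_(p | (val p).1 == (val p).2)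
    (g == inl (p, e))%:R :> X ->
    filt ((pbw_deg g)%:Z - e%:Z) (- 1) (S (pbw_gen g) - b *: 1).
  by move=> ->; rewrite -sumrB; apply: filt_sum => p _; exact: (hE p).2.
case: g hSg => [[p r]|r] hSg.
  rewrite mul0r scale0r subr0; pose b : K :=
    ((r == e) && ((val p).1 == (val p).2))%:R.
  set x := pbw_gen _; have -> : D x - S x = (D x - b *: 1) - (S x - b *: 1).
    by rewrite opprB addrA subrK.
  apply: filtB; first exact: hc.
  apply: hSg; rewrite /b -eK; case: (boolP ((val p).1 == (val p).2)) => hp;
    last first.
    rewrite andbF big1 // => q hq; case: eqP => // -[hpq _].
    by move: hp; rewrite hpq hq.
  rewrite (bigD1 p) //= big1 ?addr0 ?andbT.
    suff -> : (r == e) = (inl (p, r) == inl (p, e) :> pbw) by [].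
    by apply/eqP/eqP => [->|[]].
  by move=> q /andP[_ hq]; case: eqP => // -[hpq _]; rewrite hpq eqxx in hq.
rewrite [X in filt _ _ X]addrAC; apply: filtB; last first.
  have := hSg 0; rewrite scale0r subr0; apply; rewrite big1 // => q _.
have := symbol_on_z hD hc r; rewrite !eqxx andbT.
have -> (x : K) : x + x = x * 2 by rewrite mulr_natr mulr2n.
suff -> : (r == e) = (inr r == inr e :> pbw) by [].
by apply/eqP/eqP => [->|[]].
Qed.

End DerivationFamily.

(** * The basis theorem *)

Section Basis.
Context (K : numFieldType) (a : lie_type) (n : nat) (X : algType K).
Local Notation idx := (idx a n).
Local Notation pbw := (pbw_index a n).
Variable t : idx -> idx -> nat -> X.
Hypothesis t0 : forall i j, t i j 0 = (i == j)%:R.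
Hypothesis rtt : forall i j k l r s, rtt_lhs t i j k l r s = rtt_rhs t i j k l r s.
Hypothesis t_lift : forall m (T : idx -> idx -> nat -> matalg X m),
  (forall i j, T i j 0 = (i == j)%:R) ->
  (forall i j k l r s, rtt_lhs T i j k l r s = rtt_rhs T i j k l r s) ->
  exists2 f : {rmorphism X -> matalg X m},
    (forall c x, f (c *: x) = c *: f x) & forall i j r, f (t i j r) = T i j r.
Hypothesis t_words : forall P : X -> Prop,
  P 0 -> (forall x y, P x -> P y -> P (x + y)) ->
  (forall c w, P (c *: tword t w)) -> forall x, P x.
Variable z : nat -> X.
Hypothesis zP : is_zseries t z.
Variable i0 : idx.

(** Of the algebra only the relation, the universal property towards matrices over itself, and the
    spanning by words enter; the quotient construction stays hidden. *)
Theorem pbw_basis (le : rel pbw) : total_order le ->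
  is_basis (fun w : {w : seq pbw | sorted le w} => pword t z (val w)).
Proof.
move=> hle; have le_total : total le by case: hle.
split=> [s c us es|x].
  have H h : exists D, graded_derivation t (pbw_deg h) D /\
      forall g, filt t ((pbw_deg g)%:Z - (pbw_deg h)%:Z) (- 1)
        (D (pbw_gen t z g) - (g == h)%:R).
    by have [D hD hc] := gen_gderiv t0 rtt t_lift zP i0 h; exists D.
  have [D hD] := choice H.
  exact: (pword_free t0 zP i0 (fun h => (hD h).1) (fun h => (hD h).2) hle us es).
apply: pspan_basis; apply: (t_words (P := pspan t z (sorted le))).
- exact: pspan0.
- by move=> u v; exact: pspanD.
by move=> c w; apply/pspanZ/(pspan_sorted t0 rtt zP i0).
Qed.

End Basis.

Theorem corollary3p10 (R : realType) (a : lie_type) (n : nat)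
    (hn : admissible_rank a n)
    (z : nat -> ext_yangian R[i] a n) (hz : is_zseries (@ey_t R[i] a n) z)
    (le : rel (pbw_index a n)) (hle : total_order le) :
  is_basis (fun w : {w : seq (pbw_index a n) | sorted le w} =>
              \prod_(g <- val w) pbw_elt z g).
Proof.
(* The index n exists because the rank is at least 1. A diagonal entry at this index recovers z from
   its defining condition. *)
have i0 : idx a n.
  by exists n%:Z; rewrite mem_indices; case: a hn {z hz le hle} => /= hn; lia.
exact: (pbw_basis (@ey_t0 _ a n) (@ey_rtt _ a n)
  (fun m => @ext_yangian_lift _ a n _) (@ey_words _ a n) hz i0 hle).
Qed.
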